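(* Let $r$ be a positive integer with $N>r>\frac N2$, and let $J_r\subset\mathbb{C}[x_1,\dots,x_N]$ be the ideal of all polynomials vanishing on the union of the planes $x_{i_1}=\dots=x_{i_{r+1}}=0$ over all indexes $1\le i_1<\dots<i_{r+1}\le N$. Then the function $$\frac{f}{\prod_{i<j}^N(x_i^2-x_j^2)^{\frac1{2r}}}$$ is locally $L^2$-integrable on $\mathbb{R}^N$ for all $f\in J_r$.
   Context: A function $\Psi$ on $\mathbb{R}^N$ is locally $L^2$-integrable if every point has a neighbourhood $U$ with $\int_U|\Psi|^2dx<\infty$. Real powers are understood through absolute values (only $|\Psi|$ matters). *)

(* Defs.v *)
From HB Require Import structures.
From mathcomp Require Import all_boot all_order all_algebra.
From mathcomp Require Import complex.
From mathcomp Require Import all_classical all_reals all_analysis.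
From mathcomp Require Import measurable_realfun.
(* [mpoly] is not imported: its notations clash with those of analysis. *)
From mathcomp Require mpoly.
Set Implicit Arguments.
Unset Strict Implicit.
Unset Printing Implicit Defensive.
Import Order.TTheory GRing.Theory Num.Theory.
Import numFieldNormedType.Exports.
Local Open Scope classical_set_scope.
Local Open Scope complex_scope.
Local Open Scope ring_scope.

(* Borel sigma-algebra of the library's topology on matrices. *)
HB.instance Definition _ (R : realType) (m n : nat) :=
  @isMeasurable.Build (sigma_display (@open 'M[R]_(m, n))) 'M[R]_(m, n)
    <<s @open 'M[R]_(m, n) >> (@sigma_algebra0 _ setT _) (@sigma_algebraC _ _)
    (@sigma_algebra_bigcup _ setT _).

Section measurable_rV.
Context (R : realType) (n : nat) d (T : measurableType d).

Lemma measurable_fun_rV (f : T -> 'rV[R]_n) :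
  (forall i, measurable_fun setT (fun t => f t ord0 i)) ->
  measurable_fun setT f.
Proof.
move=> mf; apply: (@measurability _ _ _ _ _ _ (@open 'rV[R]_n)) => // _ [U oU <-].
rewrite setTI.
pose B (p : 'rV[rat]_n * nat) : set 'rV[R]_n :=
  [set v | forall i, ball (ratr (p.1 ord0 i) : R) (p.2.+1%:R^-1) (v ord0 i)].
have mB p : measurable (f @^-1` B p).
  have -> : f @^-1` B p = \bigcap_(i in [set: 'I_n])
      ((fun t => f t ord0 i) @^-1` ball (ratr (p.1 ord0 i) : R) (p.2.+1%:R^-1)).
    by apply/seteqP; split => [t Bt i _|t Bt i]; exact: Bt.
  apply: fin_bigcap_measurable; first exact: finite_finset.
  move=> i _.
  by rewrite -[X in measurable X]setTI; apply: mf => //; exact: measurable_ball.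
have -> : f @^-1` U = \bigcup_p (if `[< B p `<=` U >] then f @^-1` B p else set0).
  apply/seteqP; split => [t Ut|t [p _]]; last first.
    by case: asboolP => // BU Bt; exact: BU.
  have /nbhs_ballP[e /= e0 eU] : nbhs (f t) U by exact: open_nbhs_nbhs.
  have [k ke] : exists k : nat, k.+1%:R^-1 < e / 2.
    have := near_infty_natSinv_lt (PosNum (divr_gt0 e0 (ltr0n R 2))).
    by case=> N _ /(_ N (leqnn _)) /= NN; exists N.
  have k0 : 0 < k.+1%:R^-1 :> R by rewrite invr_gt0 ltr0n.
  have /choice[q qP] : forall i, exists q : rat,
      ball (ratr q : R) (k.+1%:R^-1) (f t ord0 i).
    move=> i.
    have /rat_in_itvoo[q] : f t ord0 i - k.+1%:R^-1 < f t ord0 i + k.+1%:R^-1.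
      by rewrite ltrD2l gtrN.
    rewrite in_itv /= => /andP[q1 q2]; exists q.
    by rewrite /ball /= ltr_distl q1 q2.
  exists (\row_i q i, k) => //; case: asboolP => [_ i /=|[]]; first by rewrite mxE.
  move=> v Bv; apply: eU; split => // i j; rewrite (ord1 i).
  have := Bv j; rewrite /= mxE => Bvj.
  apply: (@le_ball _ _ _ (k.+1%:R^-1 + k.+1%:R^-1)).
    by rewrite [leRHS]splitr lerD ?ltW.
  by apply: ball_triangle Bvj; apply: ball_sym; exact: qP.
apply: countable_bigcupT_measurable; first exact: countableP.
by move=> p; case: ifP.
Qed.

End measurable_rV.

Section lebesgue_rV.
Context (R : realType).
Implicit Type n : nat.

Definition cons_rV n (p : measurableTypeR R * 'rV[R]_n) : 'rV[R]_n.+1 :=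
  \row_i if unlift ord0 i is Some j then p.2 ord0 j else p.1.

(* Lebesgue measure on R^n as the n-fold product of [lebesgue_measure]; see
   [lebesgue_rV_rect] for its value on rectangles. *)
Fixpoint lebesgue_rV n : set 'rV[R]_n -> \bar R :=
  match n with
  | 0 => \d_(0 : 'rV[R]_0)
  | n'.+1 => pushforward (lebesgue_measure \x @lebesgue_rV n')%E (@cons_rV n')
  end.

Lemma cons_rV0 n (p : measurableTypeR R * 'rV[R]_n) : cons_rV p ord0 ord0 = p.1.
Proof. by rewrite mxE unlift_none. Qed.

Lemma cons_rVS n (p : measurableTypeR R * 'rV[R]_n) i : cons_rV p ord0 (lift ord0 i) = p.2 ord0 i.
Proof. by rewrite mxE liftK. Qed.

Lemma measurable_coord n (i : 'I_n) :
  measurable_fun setT (fun v : 'rV[R]_n => v ord0 i).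
Proof.
apply: (@measurability _ _ _ _ _ _ (@RGenOInfty.G R)).
  exact: RGenOInfty.measurableE.
move=> _ [_ [x ->] <-]; rewrite setTI; apply: sub_sigma_algebra => /=.
apply: open_comp; last exact: interval_open.
by move=> v _; exact: coord_continuous.
Qed.

Lemma measurable_cons_rV n : measurable_fun setT (@cons_rV n).
Proof.
apply: measurable_fun_rV => i; case: (unliftP ord0 i) => [j ->|->].
  under eq_fun do rewrite cons_rVS.
  exact: (measurableT_comp (measurable_coord j) measurable_snd).
by under eq_fun do rewrite cons_rV0; exact: measurable_fst.
Qed.

Definition uncons_rV n (v : 'rV[R]_n.+1) : measurableTypeR R * 'rV[R]_n :=
  (v ord0 ord0, \row_i v ord0 (lift ord0 i)).

Lemma cons_rVK n : cancel (@cons_rV n) (@uncons_rV n).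
Proof.
move=> [x v]; congr (_, _); first exact: cons_rV0.
by apply/rowP => i; rewrite mxE cons_rVS.
Qed.

Lemma measurable_uncons_rV n : measurable_fun setT (@uncons_rV n).
Proof.
apply: measurable_fun_pair; first exact: measurable_coord.
apply: measurable_fun_rV => i.
by under eq_fun do rewrite mxE; exact: measurable_coord.
Qed.

Lemma measurable_rect n (I : 'I_n -> set R) : (forall i, measurable (I i)) ->
  measurable [set v : 'rV[R]_n | forall i, I i (v ord0 i)].
Proof.
move=> mI.
rewrite [X in measurable X](_ : _ = \bigcap_(i in [set: 'I_n])
    ((fun v : 'rV[R]_n => v ord0 i) @^-1` I i)).
  apply: fin_bigcap_measurable; first exact: finite_finset.
  by move=> i _; rewrite -[X in measurable X]setTI; exact: measurable_coord.
by apply/seteqP; split => [v Iv i _|v Iv i]; exact: Iv.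
Qed.

Let lebesgue_rV_spec n :
  exists m : {sigma_finite_measure set 'rV[R]_n -> \bar R},
  @lebesgue_rV n = m /\
  forall I : 'I_n -> set R, (forall i, measurable (I i)) ->
    m [set v | forall i, I i (v ord0 i)] =
    (\prod_(i < n) lebesgue_measure (I i))%E.
Proof.
elim: n => [|n [m [mE mI]]].
  exists (\d_(0 : 'rV[R]_0)); split => // I _.
  by rewrite big_ord0 [LHS]diracE mem_set// => -[].
pose l : {sigma_finite_measure set (measurableTypeR R) -> \bar R} :=
  lebesgue_measure.
pose p : {measure set _ -> \bar R} := (l \x m)%E.
have [F TF Foo] : sigma_finite setT p.
  have /sigma_finiteP[F [TF ndF Foo]] := sigma_finiteT l.
  have /sigma_finiteP[G [TG ndG Goo]] := sigma_finiteT m.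
  exists (fun k => F k `*` G k).
    rewrite -setXTT TF TG; apply/seteqP; split => [[x y]|[x y] [k _ []]]; last first.
      by split; exists k.
    move=> [/= [i _ Fix] [j _ Gjy]]; exists (maxn i j) => //; split.
      by move: x Fix; exact/subsetPset/ndF/leq_maxl.
    by move: y Gjy; exact/subsetPset/ndG/leq_maxr.
  move=> k; have [? ?] := Foo k; have [? ?] := Goo k.
  split; first exact: measurableX.
  rewrite [X in (X < _)%E]product_measure1E//.
  by rewrite lte_mul_pinfty// ge0_fin_numE.
pose q : {measure set 'rV[R]_n.+1 -> \bar R} :=
  measure_function_pushforward__canonical__measure_function_Measure p
    (@measurable_cons_rV n).
have qE A : q A = p (@cons_rV n @^-1` A) by [].
have fq : sigma_finite setT q.
  exists (fun k => @uncons_rV n @^-1` F k).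
    by rewrite -preimage_bigcup -TF preimage_setT.
  move=> k; have [mF pF] := Foo k; split.
    by rewrite -[X in measurable X]setTI; exact: measurable_uncons_rV.
  rewrite qE [X in p X](_ : _ = F k)//.
  by apply/seteqP; split => x /=; rewrite cons_rVK.
pose H := Measure_isSigmaFinite.Build _ _ _ q fq.
pose q' := HB.pack_for {sigma_finite_measure set 'rV[R]_n.+1 -> \bar R}
  (Measure.sort q) H.
exists q'; split; first by rewrite /= mE.
move=> I IM.
have -> : q' [set v | forall i, I i (v ord0 i)] =
    p (I ord0 `*` 
      [set v : 'rV[R]_n | forall i : 'I_n, I (lift ord0 i) (v ord0 i)]).
  rewrite [LHS]qE; congr (p _); apply/seteqP; split => [x Ix|x [Ix0 IxS] i] /=.
    split; first by have := Ix ord0; rewrite cons_rV0.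
    by move=> i; have := Ix (lift ord0 i); rewrite cons_rVS.
  by case: (unliftP ord0 i) => [j ->|->]; rewrite ?cons_rV0 ?cons_rVS.
rewrite [LHS]product_measure1E; first last.
- by apply: (@measurable_rect n (fun i => I (lift ord0 i))) => i; exact: IM.
- exact: IM.
rewrite big_ord_recl; congr (_ * _)%E.
by apply: (mI (fun i => I (lift ord0 i))) => i; exact: IM.
Qed.

Let lebesgue_rV0 n : @lebesgue_rV n set0 = 0%E.
Proof. by have [m [-> _]] := lebesgue_rV_spec n. Qed.

Let lebesgue_rV_ge0 n A : (0 <= @lebesgue_rV n A)%E.
Proof. by have [m [-> _]] := lebesgue_rV_spec n. Qed.

Let lebesgue_rV_sigma_additive n : semi_sigma_additive (@lebesgue_rV n).
Proof.
by have [m [-> _]] := lebesgue_rV_spec n; exact: measure_semi_sigma_additive.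
Qed.

HB.instance Definition _ n := isMeasure.Build _ _ _ (@lebesgue_rV n)
  (@lebesgue_rV0 n) (@lebesgue_rV_ge0 n) (@lebesgue_rV_sigma_additive n).

Let lebesgue_rV_sigma_finite n : sigma_finite setT (@lebesgue_rV n).
Proof. by have [m [-> _]] := lebesgue_rV_spec n; exact: sigma_finiteT. Qed.

HB.instance Definition _ n := Measure_isSigmaFinite.Build _ _ _
  (@lebesgue_rV n) (@lebesgue_rV_sigma_finite n).

Lemma lebesgue_rV_rect n (I : 'I_n -> set R) : (forall i, measurable (I i)) ->
  lebesgue_rV [set v | forall i, I i (v ord0 i)] =
  (\prod_(i < n) lebesgue_measure (I i))%E.
Proof. by have [m [-> mI]] := lebesgue_rV_spec n; exact: mI. Qed.

End lebesgue_rV.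
Arguments lebesgue_rV {R} n _.

(* The Borel measurability that the integral presupposes is part of the
   definition. *)
Definition locally_L2 (R : realType) (n : nat) (Psi : 'rV[R]_n -> R[i]) : Prop :=
  [/\ measurable_fun setT (fun x => complex.Re (Psi x)),
      measurable_fun setT (fun x => complex.Im (Psi x)) &
      forall x : 'rV[R]_n, exists2 U : set 'rV[R]_n, open_nbhs x U &
        (\int[lebesgue_rV n]_(y in U)
           (ComplexField.Normc.normc (Psi y) ^+ 2)%:E < +oo)%E].

(* Choosing i_1 < ... < i_(r+1) is choosing the set of these r+1 indices. *)
Definition coordinate_planes (R : realType) (N r : nat) : set ('I_N -> R[i]) :=
  \bigcup_(I in [set I : {set 'I_N} | #|I| = r.+1])
    [set z | forall i, i \in I -> z i = 0].

Definition ideal_J (R : realType) (N r : nat) : set (mpoly.mpoly N R[i]) :=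
  [set f | forall z, coordinate_planes r z -> mpoly.meval z f = 0].

(* The product vanishes only on a null set, where the quotient is 0 by the
   convention 0^-1 = 0. *)
Definition quotient_fun (R : realType) (N r : nat) (f : mpoly.mpoly N R[i])
    (x : 'rV[R]_N) : R[i] :=
  mpoly.meval (fun i => (x ord0 i)%:C) f /
  (\prod_(i < N) \prod_(j < N | (i < j)%N)
     `|x ord0 i ^+ 2 - x ord0 j ^+ 2| `^ (2 * r)%:R^-1)%:C.

(* Main.v *)
(* Let y_0 <= ... <= y_(N-1) be the sorted values |x_i|, with gaps d_0 = y_0 and
   d_k = y_k - y_(k-1). Every monomial of f involves at least N - r variables, so
   locally |f| <= C y_r ... y_(N-1).  The heart of the proof is the pointwise
   inequality, on bounded sets and for N < 2 r,
     prod_(i >= r) y_i^(4 r) * prod_k d_k^(2 r - 1)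
       <= C prod_(i < j) (y_j^2 - y_i^2)^2,
   proved in homogeneous form by strong induction on N: for N <= r it follows from
   (y_j - y_i)^2 >= d_(i+1) d_j and (y_j + y_i)^2 >= d_i d_j; for N > r one splits
   at a gap comparable to y_(N-1), applies the induction hypothesis below it and
   (y_j - y_i)^2 >= d_(i+1) d_j above it.  Hence |f|^2 / prod |x_i^2 - x_j^2|^(1/r) is at most
   K prod_k d_k^(-1 + 1/(2r)).  When a coordinate is deleted, the two gaps next to
   it merge, at the cost of one factor | |x_0| - |x_j| |^(-1 + 1/(2r)) (or
   |x_0|^(-1 + 1/(2r))), whose integral over a bounded interval is bounded uniformly
   in the other coordinates; Tonelli concludes. *)
Require Import Defs.
From mathcomp Require Import all_boot all_order all_algebra.
From mathcomp Require Import complex.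
From mathcomp Require Import all_classical all_reals all_analysis.
From mathcomp Require Import measurable_realfun perm.
From mathcomp Require mpoly.
Import (coercions, canonicals) mpoly.
From mathcomp Require Import zify ring lra.
Set Implicit Arguments.
Unset Strict Implicit.
Unset Printing Implicit Defensive.
Import Order.TTheory GRing.Theory Num.Theory.
Import numFieldNormedType.Exports.
Local Open Scope ring_scope.

(** * Gaps of a sorted sequence and lower bounds for its squared Vandermonde product *)

Section gaps.
Variable R : realFieldType.
Implicit Types (y : nat -> R) (n k m : nat).

(** The first gap is measured from 0, so nonnegative gaps encode both nonnegativity and monotonicity
    of the entries, and the gaps telescope. *)
Definition gap y k := if k is l.+1 then y l.+1 - y l else y 0%N.
Arguments gap : simpl never.

(** The squared Vandermonde determinant of the [y i ^+ 2]; squaring makes it independent of the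
    order of the entries. *)
Definition vandermonde_sq y n :=
  \prod_(0 <= j < n) \prod_(0 <= i < j) (y j ^+ 2 - y i ^+ 2) ^+ 2.

Lemma sum_gap y n : \sum_(0 <= k < n.+1) gap y k = y n.
Proof.
elim: n => [|n IH]; first by rewrite big_nat1.
by rewrite big_nat_recr//= IH /gap addrC subrK.
Qed.

Lemma gap_nondecreasing y n : (forall k, (k < n)%N -> 0 <= gap y k) ->
  forall i j, (i <= j)%N -> (j < n)%N -> y i <= y j.
Proof.
move=> y0 i j; elim: j => [|j IH]; first by rewrite leqn0 => /eqP ->.
rewrite leq_eqVlt => /orP[/eqP ->//|]; rewrite ltnS => ij jn.
apply: (le_trans (IH ij (ltnW jn))).
by have := y0 _ jn; rewrite /gap subr_ge0.
Qed.

Lemma gap_ge0 y n : (forall k, (k < n)%N -> 0 <= gap y k) ->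
  forall i, (i < n)%N -> 0 <= y i.
Proof.
move=> y0 i ni; apply: (le_trans (y0 0%N _)); first exact: leq_ltn_trans ni.
exact: (gap_nondecreasing y0).
Qed.

Lemma gap_le_sub y n : (forall k, (k < n)%N -> 0 <= gap y k) ->
  forall i k j, (i < k)%N -> (k <= j)%N -> (j < n)%N -> gap y k <= y j - y i.
Proof.
move=> y0 i [//|k] j; rewrite ltnS => ik kj jn.
apply: lerB; first exact: (gap_nondecreasing y0).
by apply: (gap_nondecreasing y0) => //; exact: ltn_trans jn.
Qed.

Lemma gap_le y n : (forall k, (k < n)%N -> 0 <= gap y k) ->
  forall k j, (k <= j)%N -> (j < n)%N -> gap y k <= y j.
Proof.
move=> y0 [|k] j kj jn; first exact: (gap_nondecreasing y0).
apply: le_trans (gap_le_sub y0 (ltnSn k) kj jn) _.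
by rewrite gerBl; apply: (gap_ge0 y0); lia.
Qed.

Lemma vandermonde_sq_ge0 y n : 0 <= vandermonde_sq y n.
Proof.
by rewrite /vandermonde_sq; apply: prodr_ge0 => j _; apply: prodr_ge0 => i _; exact: sqr_ge0.
Qed.

Lemma vandermonde_sqS y n : vandermonde_sq y n.+1 =
  vandermonde_sq y n * \prod_(0 <= i < n) (y n ^+ 2 - y i ^+ 2) ^+ 2.
Proof. by rewrite /vandermonde_sq big_nat_recr. Qed.

Lemma ler_prod_nat (F G : nat -> R) a b :
  (forall i, (a <= i < b)%N -> 0 <= F i <= G i) ->
  \prod_(a <= i < b) F i <= \prod_(a <= i < b) G i.
Proof.
by move=> FG; rewrite big_nat [leRHS]big_nat; apply: ler_prod => i; exact: FG.
Qed.

Lemma prodr_nat_ge0 (F : nat -> R) a b :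
  (forall i, (a <= i < b)%N -> 0 <= F i) -> 0 <= \prod_(a <= i < b) F i.
Proof. by move=> F0; rewrite big_nat; apply: prodr_ge0 => i; exact: F0. Qed.

(** From the factorization into [a - b] and [a + b]: [p * q] bounds the squared difference and
    [c * s] the squared sum. *)
Lemma sqr_sub_sqr_ge (a b c p q s : R) : 0 <= b <= a -> 0 <= p <= a - b ->
  0 <= q <= a - b -> 0 <= c -> 0 <= s -> c * s <= (a + b) ^+ 2 ->
  (p * q) * (c * s) <= (a ^+ 2 - b ^+ 2) ^+ 2.
Proof.
move=> /andP[b0 ba] /andP[p0 pab] /andP[q0 qab] c0 s0 cs.
rewrite subr_sqr exprMn; apply: ler_pM => //; rewrite ?mulr_ge0//.
by rewrite expr2; apply: ler_pM.
Qed.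

(** Induction on [n]. Paired with [y i], the new largest entry, with gap [g], has squared difference
    at least [gap y i.+1 * g] and squared sum at least [gap y i * g]. *)
Lemma vandermonde_sq_ge_gap y n : (forall k, (k < n)%N -> 0 <= gap y k) ->
  (\prod_(0 <= l < n) gap y l) ^+ n.-1 * (\prod_(1 <= l < n) gap y l) ^+ n
    <= vandermonde_sq y n.
Proof.
elim: n => [|[|n] IH] y0.
- by rewrite /= !expr0 mulr1 /vandermonde_sq big_geq.
- by rewrite vandermonde_sqS /vandermonde_sq /= expr0 mul1r !big_geq// expr1 mulr1.
have := IH (fun k kn => y0 k (ltnW kn)).
set P := \prod_(0 <= l < _) gap y l; set Q := \prod_(1 <= l < _) gap y l => IHn.
have P0 : 0 <= P by apply: prodr_nat_ge0 => i /andP[_ hi]; apply: y0; lia.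
have Q0 : 0 <= Q by apply: prodr_nat_ge0 => i /andP[_ hi]; apply: y0; lia.
rewrite vandermonde_sqS big_nat_recr//= [X in _ * X ^+ _]big_nat_recr//= -/P -/Q.
set g := gap y n.+1.
have g0 : 0 <= g by exact: y0.
have -> : (P * g) ^+ n.+1 * (Q * g) ^+ n.+2 =
  (P ^+ n * Q ^+ n.+1) * (P * (Q * g) * g ^+ (2 * n.+1)).
  by rewrite (_ : (2 * n.+1 = n.+1 + n.+1)%N) ?exprD ?exprMn ?exprS; [ring|lia].
apply: ler_pM => //; rewrite ?mulr_ge0 ?exprn_ge0//.
(* One factor for each pair formed by the new entry and an earlier one. *)
have -> : P * (Q * g) * g ^+ (2 * n.+1) =
    \prod_(0 <= i < n.+1) ((gap y i.+1 * g) * (gap y i * g)).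
  rewrite 3!big_split/= !prodr_const_nat subn0 -/P.
  have -> : \prod_(0 <= i < n.+1) gap y i.+1 = Q * g.
    transitivity (\prod_(1 <= l < n.+2) gap y l); first by rewrite big_add1.
    by rewrite big_nat_recr.
  by rewrite mul2n -addnn exprD; ring.
apply: ler_prod_nat => i /andP[_ ni].
have gi : 0 <= gap y i by apply: y0; lia.
have gi1 : 0 <= gap y i.+1 by exact: y0.
have yi : 0 <= y i by apply: (gap_ge0 y0); lia.
rewrite !mulr_ge0//=; apply: sqr_sub_sqr_ge => //.
- by rewrite yi andTb; apply: (gap_nondecreasing y0) => //; lia.
- by rewrite gi1 andTb; apply: (gap_le_sub y0).
- by rewrite g0 andTb; apply: (gap_le_sub y0).
have h1 : gap y i <= y n.+1 by apply: (gap_le y0) => //; lia.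
have h2 : g <= y n.+1 by apply: (gap_le y0).
by rewrite expr2; apply: ler_pM => //; apply: (@le_trans _ _ (y n.+1)) => //; rewrite lerDl.
Qed.

(** Pairs below [k] are kept. A pair across [k] has difference and sum at least [D], which gives
    [D ^+ 4]. A pair [i < j] from [k] on has sum at least [D] and squared difference at least
    [gap y i.+1 * gap y j]; each gap above [k] is thus collected [m] times. *)
Lemma vandermonde_sq_split y k m (D : R) : (forall l, (l < k + m)%N -> 0 <= gap y l) ->
  (0 < m)%N -> 0 <= D <= gap y k ->
  vandermonde_sq y k * D ^+ (4 * k * m + m * m.-1) *
    (\prod_(k.+1 <= l < k + m) gap y l) ^+ m <= vandermonde_sq y (k + m).
Proof.
elim: m => // -[_|m IH] y0 _ /andP[D0 Dk].
  rewrite addn1 vandermonde_sqS muln0 addn0 big_geq// expr1n mulr1 muln1.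
  apply: ler_wpM2l; first exact: vandermonde_sq_ge0.
  rewrite exprM -[X in _ ^+ X <= _]subn0 -prodr_const_nat.
  apply: ler_prod_nat => i /andP[_ ik].
  have yi : 0 <= y i by apply: (gap_ge0 y0); lia.
  have h : gap y k <= y k - y i by apply: (gap_le_sub y0); lia.
  rewrite exprn_ge0//= (_ : D ^+ 4 = (D * D) * (D * D)); last by ring.
  apply: sqr_sub_sqr_ge => //.
  - by rewrite yi andTb; apply: (gap_nondecreasing y0); lia.
  - by rewrite D0 (le_trans Dk).
  - by rewrite D0 (le_trans Dk).
  have hD : D <= y k + y i by lra.
  by rewrite expr2; apply: ler_pM.
have y0' l : (l < k + m.+1)%N -> 0 <= gap y l by move=> lk; apply: y0; lia.
have := IH y0' isT; rewrite D0 Dk => /(_ isT).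
set Q := \prod_(_ <= l < _) gap y l => {IH} IHn.
have Q0 : 0 <= Q by apply: prodr_nat_ge0 => i /andP[_ hi]; apply: y0; lia.
rewrite addnS vandermonde_sqS big_nat_recr//=; last by lia.
rewrite -/Q; set g := gap y (k + m.+1).
have g0 : 0 <= g by apply: y0; lia.
have yn0 : 0 <= y (k + m.+1)%N by apply: (gap_ge0 y0); lia.
have Dn : D <= y (k + m.+1)%N by apply: le_trans Dk _; apply: (gap_le y0); lia.
have -> : vandermonde_sq y k * D ^+ (4 * k * m.+2 + m.+2 * m.+1) * (Q * g) ^+ m.+2 =
  (vandermonde_sq y k * D ^+ (4 * k * m.+1 + m.+1 * m) * Q ^+ m.+1) *
   (D ^+ (4 * k) * (Q * g * g ^+ m.+1 * D ^+ (2 * m.+1))).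
  rewrite (_ : 4 * k * m.+2 + m.+2 * m.+1 =
    (4 * k * m.+1 + m.+1 * m) + (4 * k) + 2 * m.+1)%N; last by lia.
  by rewrite !exprD !exprMn (exprS Q m.+1) (exprS g m.+1); ring.
apply: ler_pM => //; rewrite ?mulr_ge0 ?exprn_ge0 ?vandermonde_sq_ge0//.
rewrite [leRHS](@big_cat_nat _ _ _ k)//=; last by lia.
apply: ler_pM => //; rewrite ?mulr_ge0 ?exprn_ge0//.
  rewrite exprM -[X in _ ^+ X <= _]subn0 -prodr_const_nat.
  apply: ler_prod_nat => i /andP[_ ik].
  have yi : 0 <= y i by apply: (gap_ge0 y0); lia.
  have h : gap y k <= y (k + m.+1)%N - y i by apply: (gap_le_sub y0); lia.
  rewrite exprn_ge0//= (_ : D ^+ 4 = (D * D) * (D * D)); last by ring.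
  apply: sqr_sub_sqr_ge => //.
  - by rewrite yi andTb; apply: (gap_nondecreasing y0); lia.
  - by rewrite D0 (le_trans Dk).
  - by rewrite D0 (le_trans Dk).
  have hD : D <= y (k + m.+1)%N + y i by lra.
  by rewrite expr2; apply: ler_pM.
have -> : Q * g * g ^+ m.+1 * D ^+ (2 * m.+1) =
    \prod_(k <= i < k + m.+1) ((gap y i.+1 * g) * (D * D)).
  rewrite 2!big_split/= !prodr_const_nat addKn.
  have -> : \prod_(k <= i < k + m.+1) gap y i.+1 = Q * g.
    transitivity (\prod_(k.+1 <= l < (k + m.+1).+1) gap y l); first by rewrite big_add1.
    by rewrite big_nat_recr//; lia.
  by rewrite exprM expr2.
apply: ler_prod_nat => i /andP[ki ni].
have gi1 : 0 <= gap y i.+1 by apply: y0; lia.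
have yi : 0 <= y i by apply: (gap_ge0 y0); lia.
rewrite !mulr_ge0//=; apply: sqr_sub_sqr_ge => //.
- by rewrite yi andTb; apply: (gap_nondecreasing y0) => //; lia.
- by rewrite gi1 andTb; apply: (gap_le_sub y0); lia.
- by rewrite g0 andTb; apply: (gap_le_sub y0); lia.
by rewrite expr2; apply: ler_pM => //; rewrite (le_trans Dn)// lerDl.
Qed.

End gaps.

(** * The homogeneous inequality between entries, gaps and the Vandermonde product *)

Section vandermonde_bound.
Variables (R : realFieldType) (r : nat).
Implicit Types (y : nat -> R) (n k m : nat).

(* The homogeneity degree that makes both sides of
   [prod_gap_le_vandermonde_sq] scale alike. *)
Definition excess n : nat :=
  (if n <= r then n * (2 * r + 1 - 2 * n) else 2 * (n - r) * (2 * r - n) + n)%N.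

(** Exponent count for the induction step. On the left, the powers of the largest entry come from
    the induction hypothesis, the numerator, gap [k], and the surplus powers of the gaps above it;
    on the right, from the power of [D] in [vandermonde_sq_split] and the target. *)
Lemma excess_split n k : (r < n)%N -> (n < 2 * r)%N -> (k < n)%N ->
  (excess k + 4 * r * (n - maxn r k) + (2 * r).-1 +
     ((2 * r).-1 - (n - k)) * (n - k).-1 =
   4 * k * (n - k) + (n - k) * (n - k).-1 + excess n)%N.
Proof.
move=> rn nr kn; rewrite /excess (leqNgt n) rn /=.
(* Naming the slack in each inequality turns truncated subtractions into additions. *)
have [b bE] : exists b, n = (r + b.+1)%N by exists (n - r).-1; lia.
have [c cE] : exists c, r = (b + c + 2)%N by exists (2 * r - n).-1; lia.
have [kr|rk] := leqP k r.
  have [a aE] : exists a, r = (k + a)%N by exists (r - k)%N; lia.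
  rewrite (_ : 2 * r + 1 - 2 * k = 2 * a + 1)%N; last by lia.
  rewrite (_ : n - k = (a + b).+1)%N; last by lia.
  rewrite (_ : n - r = b.+1)%N; last by lia.
  rewrite (_ : 2 * r - n = c.+1)%N; last by lia.
  rewrite (_ : (2 * r).-1 - (a + b).+1 = k + c)%N; last by lia.
  rewrite (_ : (2 * r).-1 = k + a + b + c + 1)%N /=; last by lia.
  have -> : n = (k + a + b + 1)%N by lia.
  have : (k + a = b + c + 2)%N by lia.
  have [ac|/ltnW ca] := leqP a c.
    have [d ->] : exists d, c = (a + d)%N by exists (c - a)%N; lia.
    by move=> kE; have -> : k = (b + d + 2)%N by [lia]; have -> : r = (b + (a + d) + 2)%N by [lia]; lia.
  have [d ->] : exists d, a = (c + d)%N by exists (a - c)%N; lia.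
  have -> : r = (b + c + 2)%N by [].
  case: k kn {kr aE} => [|[|k]] _ kE.
  - by have -> : d = (b + 2)%N by [lia]; lia.
  - by have -> : d = (b + 1)%N by [lia]; lia.
  - by have -> : b = (k + d)%N by [lia]; lia.
have [a aE] : exists a, k = (r + a.+1)%N by exists (k - r).-1; lia.
have [d dE] : exists d, b = (a + d.+1)%N by exists (b - a).-1; lia.
rewrite (_ : n - k = d.+1)%N; last by lia.
rewrite (_ : n - r = b.+1)%N; last by lia.
rewrite (_ : k - r = a.+1)%N; last by lia.
rewrite (_ : 2 * r - n = c.+1)%N; last by lia.
rewrite (_ : 2 * r - k = c + d + 2)%N; last by lia.
rewrite (_ : (2 * r).-1 - d.+1 = 2 * a + d + 2 * c + 4)%N; last by lia.
rewrite (_ : (2 * r).-1 = 2 * a + 2 * d + 2 * c + 5)%N; last by lia.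
by rewrite aE bE cE dE /=; lia.
Qed.

(** The gaps sum to [y n], so one of them is at least their average. *)
Lemma exists_large_gap y n : (forall k, (k < n.+1)%N -> 0 <= gap y k) ->
  exists2 k, (k < n.+1)%N & y n / n.+1%:R <= gap y k.
Proof.
move=> y0; apply/not_exists2P => small.
have : \sum_(0 <= k < n.+1) gap y k < \sum_(0 <= k < n.+1) (y n / n.+1%:R).
  rewrite !big_mkord; apply: ltr_sum => [|i _]; first by apply/hasP; exists ord0; rewrite ?mem_index_enum.
  by have [/(_ (ltn_ord i))//|/negP] := small i; rewrite -ltNge.
by rewrite sum_gap big_mkord sumr_const card_ord -[X in _ < X]mulr_natr mulfVK ?pnatr_eq0// ltxx.
Qed.

(** One constant serves all [n <= N], as strong induction requires; any upper bound [T] may stand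
    for the largest entry. *)
Lemma prod_gap_le_vandermonde_sq N : (N < 2 * r)%N ->
  exists2 C : R, 1 <= C & forall n y T, (n <= N)%N ->
    (forall k, (k < n)%N -> 0 <= gap y k) -> (forall k, (k < n)%N -> y k <= T) ->
    0 <= T ->
    \prod_(r <= i < n) y i ^+ (4 * r) *
      (\prod_(0 <= k < n) gap y k) ^+ (2 * r).-1 <=
    C * T ^+ excess n * vandermonde_sq y n.
Proof.
elim: N => [|N IH] N2r.
  exists 1 => // n y T; rewrite leqn0 => /eqP -> _ _ _.
  by rewrite /vandermonde_sq /excess !big_geq// expr1n mul0n expr0 !mulr1.
have [C C1 HC] := IH (ltnW N2r).
(* Dominates the exponent [E] of [D] at every possible split point. *)
pose p := (4 * N.+1 * N.+1 + N.+1 * N.+1)%N.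
have N1 : 1 <= N.+1%:R :> R by rewrite ler1n.
have p1 : 1 <= N.+1%:R ^+ p :> R by exact: exprn_ege1.
exists (C * N.+1%:R ^+ p); first by rewrite mulr_ege1.
move=> n y T; rewrite leq_eqVlt => /orP[/eqP ->{n}|]; last first.
  rewrite ltnS => nN y0 yT T0; apply: le_trans (HC _ _ _ nN y0 yT T0) _.
  apply: ler_wpM2r; first exact: vandermonde_sq_ge0.
  by apply: ler_wpM2r; rewrite ?exprn_ge0// ler_peMr// (le_trans _ C1).
set n := N.+1 => y0 yT T0.
have C0 : 0 <= C by exact: le_trans C1.
have V0 := vandermonde_sq_ge0 y n.
have [nr|rn] := leqP n r.
  rewrite big_geq// mul1r.
  apply: (@le_trans _ _ (T ^+ excess n * vandermonde_sq y n)); last first.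
    by apply: ler_wpM2r => //; rewrite ler_peMl ?exprn_ge0// mulr_ege1.
  apply: le_trans (ler_wpM2l _ (vandermonde_sq_ge_gap y0)); last exact: exprn_ge0.
  rewrite (_ : excess n = n + n * (2 * r - 2 * n))%N; last by rewrite /excess nr; nia.
  set P := \prod_(0 <= k < n) gap y k; set Q := \prod_(1 <= k < n) gap y k.
  have P0 : 0 <= P by apply: prodr_nat_ge0 => i /andP[_]; exact: y0.
  have Q0 : 0 <= Q by apply: prodr_nat_ge0 => i /andP[_]; exact: y0.
  have PTQ : P <= T * Q.
    rewrite /P big_ltn//; apply: ler_wpM2r => //.
    by apply: le_trans (yT 0%N isT); exact: (gap_le y0).
  have PT : P <= T ^+ n.
    rewrite /P -[X in _ ^+ X]subn0 -prodr_const_nat; apply: ler_prod_nat => i /andP[_ ni].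
    by rewrite y0//= (le_trans (gap_le y0 (leqnn i) ni))// yT.
  (* Of the [(2 * r).-1] copies of [P], [n.-1] are kept, [n] are bounded by [T * Q], which trades
     the first gap for [T], and the rest by [T ^+ n]. *)
  rewrite (_ : (2 * r).-1 = n.-1 + n + (2 * r - 2 * n))%N; last by move: nr; rewrite /n; clear; lia.
  rewrite 2!(exprD P) (exprD T) (exprM T) mulrC [leRHS](_ : _ = (T ^+ n) ^+ (2 * r - 2 * n) *
     (P ^+ n.-1 * (T ^+ n * Q ^+ n))); last by ring.
  apply: ler_pM; rewrite ?mulr_ge0 ?exprn_ge0//; first by rewrite lerXn2r ?nnegrE ?exprn_ge0.
  by apply: ler_wpM2l; rewrite ?exprn_ge0// -exprMn lerXn2r ?nnegrE ?mulr_ge0.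
have [k kn Dk] := exists_large_gap y0.
set t := y N in Dk.
have t0 : 0 <= t by exact: (gap_ge0 y0).
(* [D] is the largest entry up to the factor [n], so its powers turn back into powers of [t] at the
   cost of a constant. *)
pose D := t / n%:R; have D0 : 0 <= D by rewrite divr_ge0.
have tD : t = n%:R * D by rewrite mulrC mulfVK// pnatr_eq0.
pose m := (n - k)%N.
have m0 : (0 < m)%N by rewrite subn_gt0.
have km : (k + m = n)%N by rewrite subnKC// ltnW.
have yt i : (i < n)%N -> y i <= t by move=> ni; apply: (gap_nondecreasing y0).
have yi0 i : (i < n)%N -> 0 <= y i by move=> ni; apply: (gap_ge0 y0).
have gt i : (i < n)%N -> gap y i <= t.
  by move=> ni; apply: le_trans (yt _ ni); exact: (gap_le y0).
have := @vandermonde_sq_split R y k m D; rewrite km D0 Dk => /(_ y0 m0 isT).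
set Q := \prod_(k.+1 <= l < n) gap y l => HV.
have Q0 : 0 <= Q by apply: prodr_nat_ge0 => i /andP[_]; exact: y0.
have Vk0 := vandermonde_sq_ge0 y k.
have y0k i : (i < k)%N -> 0 <= gap y i by move=> ik; apply: y0; exact: ltn_trans kn.
have ytk i : (i < k)%N -> y i <= t by move=> ik; apply: yt; exact: ltn_trans kn.
have HI := HC k y t kn y0k ytk t0.
(* Entries below the split are left to the induction hypothesis; the others are bounded by [t]. *)
have num : \prod_(r <= i < n) y i ^+ (4 * r) <=
    \prod_(r <= i < k) y i ^+ (4 * r) * t ^+ (4 * r * (n - maxn r k)).
  have tail a : \prod_(a <= i < n) y i ^+ (4 * r) <= t ^+ (4 * r * (n - a)).
    rewrite exprM -prodr_const_nat; apply: ler_prod_nat => i /andP[_ ni].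
    by rewrite exprn_ge0 ?yi0//= lerXn2r ?nnegrE ?yi0// yt.
  have [kr|rk] := leqP k r.
    by rewrite [X in X * _]big_geq// mul1r.
  rewrite (@big_cat_nat _ _ _ k) ?(ltnW rk) ?(ltnW kn)//=; apply: ler_wpM2l => //.
  by apply: prodr_nat_ge0 => i /andP[_ ik]; rewrite exprn_ge0// yi0//; exact: ltn_trans kn.
set q := (2 * r).-1 in HI *.
have gaps : (\prod_(0 <= l < n) gap y l) ^+ q <=
    (\prod_(0 <= l < k) gap y l) ^+ q * (t ^+ q * (Q ^+ m * t ^+ ((q - m) * m.-1))).
  rewrite (@big_cat_nat _ _ _ k) ?(ltnW kn)//= (@big_ltn _ _ _ k)//= -/Q !exprMn.
  apply: ler_wpM2l.
    by apply: exprn_ge0; apply: prodr_nat_ge0 => i /andP[_]; exact: y0k.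
  apply: ler_pM; rewrite ?exprn_ge0 ?y0//.
    by rewrite lerXn2r ?nnegrE ?y0// gt.
  (* Since [n < 2 * r], the power [q] of [Q] contains the [m] copies supplied by the split; the
     surplus is bounded by [t]. *)
  have mq : (m <= q)%N by move: N2r; rewrite /m /q /n; clear; lia.
  rewrite -{1}(subnKC mq).
  rewrite exprD; apply: ler_wpM2l; first exact: exprn_ge0.
  rewrite mulnC exprM lerXn2r ?nnegrE ?exprn_ge0//.
  rewrite (_ : m.-1 = n - k.+1)%N; last by rewrite /m subnS.
  rewrite -prodr_const_nat; apply: ler_prod_nat => i /andP[_ ni].
  by rewrite y0//= gt.
apply: (@le_trans _ _ (C * n%:R ^+ p * t ^+ excess n * vandermonde_sq y n)); last first.
  apply: ler_wpM2r => //; apply: ler_wpM2l; first by rewrite mulr_ge0// exprn_ge0.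
  by rewrite lerXn2r ?nnegrE// yT.
pose E := (4 * k * m + m * m.-1)%N.
apply: (@le_trans _ _ (C * n%:R ^+ E * t ^+ excess n *
    (vandermonde_sq y k * D ^+ E * Q ^+ m))); last first.
  apply: ler_pM => //; rewrite ?mulr_ge0 ?exprn_ge0//.
  apply: ler_wpM2r; first exact: exprn_ge0.
  apply: ler_wpM2l => //; apply: ler_weXn2l => //.
  by move: kn; rewrite /E /p -/n /m; clear => kn; apply: leq_add; apply: leq_mul; rewrite ?leq_mul//; lia.
have -> : C * n%:R ^+ E * t ^+ excess n * (vandermonde_sq y k * D ^+ E * Q ^+ m) =
    C * vandermonde_sq y k * Q ^+ m * t ^+ (E + excess n).
  have -> : t ^+ (E + excess n) = n%:R ^+ E * D ^+ E * t ^+ excess n.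
    by rewrite exprD [in LHS]tD exprMn -tD.
  ring.
have := excess_split rn N2r kn; rewrite -/m -/E => <-.
apply: (@le_trans _ _ ((C * t ^+ excess k * vandermonde_sq y k) *
   (t ^+ (4 * r * (n - maxn r k)) * (t ^+ q * (Q ^+ m * t ^+ ((q - m) * m.-1)))))); last first.
  by rewrite !exprD le_eqVlt; apply/orP; left; apply/eqP; ring.
apply: le_trans (ler_wpM2r _ HI); last by rewrite !mulr_ge0 ?exprn_ge0.
apply: le_trans (ler_pM _ _ num gaps) _.
- by apply: prodr_nat_ge0 => i /andP[_ ni]; rewrite exprn_ge0// yi0.
- by apply: exprn_ge0; apply: prodr_nat_ge0 => i /andP[_]; exact: y0.
by rewrite le_eqVlt; apply/orP; left; apply/eqP; ring.
Qed.

End vandermonde_bound.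

(** * Coefficients of a polynomial that vanishes on a coordinate plane *)

Section monomials.

(** The naturals below [size p] are distinct roots, one more than the degree allows. *)
Lemma eq0_of_horner_eq0 (R : numDomainType) (p : {poly R}) :
  (forall t, p.[t] = 0) -> p = 0.
Proof.
move=> p0; apply: (@roots_geq_poly_eq0 _ p [seq i%:R | i <- iota 0 (size p)]).
- by apply/allP => t _; apply/rootP/p0.
- by rewrite map_inj_in_uniq ?iota_uniq// => i j _ _ /eqP; rewrite eqr_nat => /eqP.
- by rewrite size_map size_iota.
Qed.

(** The lowest digit in base [B] is the residue modulo [B]; once it is cancelled, dividing by [B]
    leaves a shorter expansion. *)
Lemma digits_inj (B n : nat) (a b : 'I_n -> nat) :
  (forall i, a i < B)%N -> (forall i, b i < B)%N ->
  (\sum_i a i * B ^ i = \sum_i b i * B ^ i)%N -> a =1 b.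
Proof.
elim: n a b => [|n IH] a b aB bB; first by move=> _ [].
rewrite !big_ord_recl !muln1 => ab.
have split_sum (c : 'I_n.+1 -> nat) : (\sum_(i < n) c (lift ord0 i) * B ^ lift ord0 i =
    (\sum_(i < n) c (lift ord0 i) * B ^ i) * B)%N.
  rewrite big_distrl/=; apply: eq_bigr => i _; rewrite /bump/= add1n expnSr; lia.
rewrite !split_sum in ab.
have ab0 : a ord0 = b ord0.
  by have := congr1 (modn^~ B) ab; rewrite /= ![(_ + _ * B)%N]addnC !modnMDl !modn_small.
move: ab; rewrite ab0 => /addnI /eqP.
rewrite eqn_mul2r; case: eqP => [B0|_ /= /eqP ab] i; first by have := aB ord0; rewrite B0.
case: (unliftP ord0 i) => [j ->|-> //].
by move: j; apply: IH ab => j.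
Qed.

(* Kronecker substitution: for B larger than every exponent of f, the values
   z_i = t^(B^i) off I and z_i = 0 on I send the monomials not involving I to
   distinct powers of t. *)
Lemma mcoeff_eq0_of_vanish (R : numDomainType) (n : nat) (f : mpoly.mpoly n R)
    (I : {set 'I_n}) :
  (forall z : 'I_n -> R, (forall i, i \in I -> z i = 0) -> mpoly.meval z f = 0) ->
  forall m : mpoly.multinom n, (forall i, i \in I -> m i = 0%N) ->
    mpoly.mcoeff m f = 0.
Proof.
move=> fI m mI; apply/eqP/contraT; rewrite -mpoly.mcoeff_msupp => mf.
pose B := (\max_(k <- mpoly.msupp f) mpoly.mdeg k).+1.
have mB (k : mpoly.multinom n) : k \in mpoly.msupp f -> forall i, (k i < B)%N.
  move=> kf i; rewrite ltnS; apply: leq_trans (leq_bigmax_seq _ kf isT).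
  by rewrite mpoly.mdegE (bigD1 i)//= leq_addr.
pose e (k : mpoly.multinom n) := (\sum_i k i * B ^ i)%N.
pose onI (k : mpoly.multinom n) := [forall i in I, k i == 0%N].
pose q : {poly R} := \sum_(k <- mpoly.msupp f | onI k) mpoly.mcoeff k f *: 'X^(e k).
have q0 : q = 0.
  apply: eq0_of_horner_eq0 => t.
  rewrite -[RHS](fI (fun i => if i \in I then 0 else t ^+ (B ^ i))); last by move=> i ->.
  rewrite mpoly.mevalE horner_sum [RHS](bigID onI)/= [X in _ + X]big1 ?addr0.
    apply: eq_bigr => k /forall_inP kI.
    rewrite hornerZ hornerXn /e -prodrXr; congr (_ * _); apply: eq_bigr => i _.
    case: ifPn => [iI|_]; first by rewrite (eqP (kI i iI)) mul0n !expr0.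
    by rewrite -exprM mulnC.
  move=> k; rewrite negb_forall_in => /exists_inP[i iI ki].
  by rewrite (bigD1 i)//= iI expr0n (negPf ki) mul0r mulr0.
(* By [digits_inj], only [m] contributes to degree [e m], so this coefficient of [q] is
   [mcoeff m f], which is nonzero by [mf]. *)
have := congr1 (fun p : {poly R} => p`_(e m)) q0.
rewrite coef0 coef_sum big_mkcond (bigD1_seq m) ?mpoly.msupp_uniq//=.
rewrite (_ : onI m) ?coefZ ?coefXn ?eqxx ?mulr1; last first.
  by apply/forall_inP => i /mI ->.
rewrite big1_seq ?addr0 => [/eqP|k /andP[km kf]].
  by rewrite mpoly.mcoeff_eq0 mf.
case: ifP => // _; rewrite coefZ coefXn; case: eqP => [emk|]; last by rewrite mulr0.
case/eqP: km; apply/mpoly.mnmP => i.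
by apply: esym; apply: digits_inj emk i => i; exact: mB.
Qed.

End monomials.

(** * Permutation invariance and comparison of partial products *)

Section pointwise.

(** Permuting the columns of a Vandermonde matrix changes its determinant by a sign, which squaring
    removes. *)
Lemma prod_sub_sqr_perm (R : comNzRingType) n (a : 'I_n -> R) (s : 'S_n) :
  (\prod_(i < n) \prod_(j < n | (i < j)%N) (a (s j) - a (s i))) ^+ 2 =
  (\prod_(i < n) \prod_(j < n | (i < j)%N) (a j - a i)) ^+ 2.
Proof.
have detE (b : 'I_n -> R) : \prod_(i < n) \prod_(j < n | (i < j)%N) (b j - b i) =
    \det (Vandermonde n (\row_i b i)).
  by rewrite det_Vandermonde; under [RHS]eq_bigr do under eq_bigr do rewrite !mxE.
rewrite (detE a) (detE (a \o s)).
have -> : Vandermonde n (\row_i (a \o s) i) = col_perm s (Vandermonde n (\row_i a i)).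
  by apply/matrixP => i j; rewrite !mxE.
by rewrite col_permE det_mulmx det_perm exprMn sqrr_sign mulr1.
Qed.

Lemma vandermonde_sqE (R : realFieldType) (y : nat -> R) n :
  vandermonde_sq y n =
  (\prod_(i < n) \prod_(j < n | (i < j)%N) (y j ^+ 2 - y i ^+ 2)) ^+ 2.
Proof.
rewrite (exchange_big_dep predT)//= /vandermonde_sq big_mkord -prodrXl.
apply: eq_bigr => j _; rewrite big_mkord -prodrXl.
by rewrite (big_ord_widen _ (fun i => (y j ^+ 2 - y i ^+ 2) ^+ 2) (ltnW (ltn_ord j))).
Qed.

(** Cancel the common factors. What remains on the left is at most [w r] per factor, on the right at
    least [w r]; the left has at least as many factors left over, and [w r <= 1]. *)
Lemma prod_le_prod_top (R : realFieldType) (w : nat -> R) (N r : nat) (P : pred 'I_N) :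
  (r < N)%N -> (forall i j, (i <= j)%N -> (j < N)%N -> w i <= w j) ->
  (forall i, (i < N)%N -> 0 <= w i <= 1) -> (#|[pred i | ~~ P i]| <= r)%N ->
  \prod_(i < N | P i) w i <= \prod_(r <= i < N) w i.
Proof.
move=> rN wmono w01 Pr.
have w0 (i : 'I_N) : 0 <= w i by have /andP[] := w01 i (ltn_ord i).
have /andP[c0 c1] := w01 r rN.
pose lo := [pred i : 'I_N | (i < r)%N].
have -> : \prod_(r <= i < N) w i = \prod_(i < N | ~~ lo i) w i.
  by rewrite big_geq_mkord; apply: eq_bigl => i; rewrite /= -leqNgt.
rewrite (bigID lo)/= mulrC [leRHS](bigID P)/=.
under [X in _ <= X * _]eq_bigl do rewrite andbC.
apply: ler_wpM2l; first by apply: prodr_ge0.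
apply: (@le_trans _ _ (\prod_(i < N | P i && lo i) w r)).
  by apply: ler_prod => i /andP[_ ir]; rewrite w0 wmono// ltnW.
apply: (@le_trans _ _ (\prod_(i < N | ~~ lo i && ~~ P i) w r)); last first.
  by apply: ler_prod => i /andP[ir _]; rewrite c0 wmono// leqNgt.
rewrite !prodr_const; apply: ler_wiXn2l => //.
have card_lo : #|lo| = r.
  by rewrite -sum1_card -[RHS]card_ord -sum1_card (big_ord_widen _ (fun=> 1%N) (ltnW rN)).
(* The indices below [r] number [r], those outside [P] at most [r]; removing their common part from
   both compares the leftovers. *)
have loP := cardID P lo; have Plo := cardID lo [pred i | ~~ P i].
rewrite card_lo in loP.
rewrite -(leq_add2l #|[predI [pred i | ~~ P i] & lo]|).
apply: (@leq_trans r).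
  apply: leq_trans Pr; rewrite -Plo leq_add2l; apply/subset_leq_card/fintype.subsetP => i.
  by rewrite !inE.
rewrite -[leqLHS]loP addnC; apply: leq_add; apply/subset_leq_card/fintype.subsetP => i.
  by rewrite !inE.
by rewrite !inE andbC.
Qed.
End pointwise.

(** * Bound on a polynomial of the ideal by the largest coordinates *)

Section quotient_bound.
Variables (R : realType) (N r : nat).
Implicit Types (y : nat -> R) (x : 'rV[R]_N) (f : mpoly.mpoly N R[i]).

Local Notation normc := ComplexField.Normc.normc.

Lemma normc_sum (I : Type) (s : seq I) (F : I -> R[i]) :
  normc (\sum_(i <- s) F i) <= \sum_(i <- s) normc (F i).
Proof.
elim: s => [|i s IH]; first by rewrite !big_nil ComplexField.Normc.normc0.
by rewrite !big_cons; apply: le_trans (le_normcD _ _) _; rewrite lerD2l.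
Qed.

Lemma normc_ge0 (z : R[i]) : 0 <= normc z.
Proof. by case: z => a b; exact: sqrtr_ge0. Qed.

Lemma normc_real (a : R) : normc (a%:C)%C = `|a|.
Proof. by rewrite /= expr0n addr0 sqrtr_sqr. Qed.

Lemma normc_monomial (x : 'I_N -> R) (m : 'I_N -> nat) :
  normc (\prod_i ((x i)%:C)%C ^+ m i) = \prod_i `|x i| ^+ m i.
Proof.
have -> : \prod_i `|x i| ^+ m i = `|\prod_i x i ^+ m i|.
  by rewrite normr_prod; apply: eq_bigr => i _; rewrite normrX.
rewrite -normc_real rmorph_prod; congr normc.
by apply: eq_bigr => i _; rewrite rmorphXn.
Qed.

(* Vanishing on the planes forces every monomial of f to involve at least N - r
   variables, and their product is at most that of the N - r largest ones. *)
Lemma ideal_J_bound f (M : R) : ideal_J r f -> (r < N)%N -> 1 <= M ->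
  exists2 C : R, 0 <= C & forall x y (s : 'S_N),
    (forall i, `|x ord0 i| <= M) -> (forall i : 'I_N, y i = `|x ord0 (s i)|) ->
    (forall k, (k < N)%N -> 0 <= gap y k) ->
    normc (mpoly.meval (fun i => (x ord0 i)%:C%C) f) <= C * \prod_(r <= i < N) y i.
Proof.
move=> fJ rN M1; have M0 : 0 < M by exact: lt_le_trans M1.
(* Dividing by [M] brings the entries into the unit interval; scaling back costs [M ^+ mdeg m] per
   monomial. *)
exists (\sum_(m <- mpoly.msupp f) normc (mpoly.mcoeff m f) * M ^+ mpoly.mdeg m).
  by apply: sumr_ge0 => m _; rewrite mulr_ge0 ?normc_ge0 ?exprn_ge0 ?(ltW M0).
move=> x y s xM yx y0.
rewrite mpoly.mevalE; apply: le_trans (normc_sum _ _) _.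
rewrite mulr_suml big_seq [leRHS]big_seq; apply: ler_sum => m mf.
rewrite ComplexField.Normc.normcM normc_monomial -mulrA.
apply: ler_wpM2l; first exact: normc_ge0.
have zeros : (#|[pred i | ~~ (m (s i) != 0%N)]| <= r)%N.
  rewrite leqNgt; apply/negP => r_lt.
  (* With more than [r] absent variables, [r.+1] of them define a plane on which [f] vanishes, and
     the coefficient of [m] would be 0. *)
  pose Z := finset (fun i => m i == 0%N).
  have rZ : (r < #|Z|)%N.
    apply: leq_trans r_lt _; rewrite -!sum1_card [leqRHS](reindex_inj (@perm_inj _ s))/=.
    by apply: eq_leq; apply: eq_bigl => i; rewrite !inE negbK.
  have : (0 < 'C(#|Z|, r.+1))%N by rewrite bin_gt0.
  rewrite -cards_draws => /card_gt0P[I]; rewrite inE => /andP[IZ /eqP Ir].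
  move: mf; rewrite mpoly.mcoeff_msupp => /eqP; apply.
  apply: (@mcoeff_eq0_of_vanish _ _ _ I) => [z zI|i iI].
    by apply: fJ; exists I.
  by have := fintype.subsetP IZ i iI; rewrite inE => /eqP.
pose w k := y k / M.
have wmono i j : (i <= j)%N -> (j < N)%N -> w i <= w j.
  by move=> ij jN; rewrite ler_pM2r ?invr_gt0//; exact: (gap_nondecreasing y0).
have w01 i : (i < N)%N -> 0 <= w i <= 1.
  move=> iN; rewrite divr_ge0 ?(gap_ge0 y0) ?(ltW M0)//= ler_pdivrMr// mul1r.
  by rewrite (yx (Ordinal iN)).
have top := prod_le_prod_top rN wmono w01 zeros.
apply: (@le_trans _ _ (M ^+ mpoly.mdeg m * \prod_(r <= i < N) w i)); last first.
  apply: ler_wpM2l; first by rewrite exprn_ge0// ltW.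
  apply: ler_prod_nat => i /andP[_ iN]; have /andP[-> _] /= := w01 i iN.
  by rewrite ler_pdivrMr// ler_peMr// (gap_ge0 y0).
apply: le_trans (ler_wpM2l _ top); last by rewrite exprn_ge0// ltW.
rewrite mpoly.mdegE -prodrXr (reindex_inj (@perm_inj _ s))/= [X in _ <= X * _](reindex_inj (@perm_inj _ s))/=.
rewrite [X in _ <= _ * X]big_mkcond -big_split/=; apply: ler_prod => i _.
rewrite exprn_ge0//= -yx; have [->|mi] /= := eqVneq (m (s i)) 0%N; first by rewrite !expr0 mulr1.
have /andP[wi0 wi1] := w01 i (ltn_ord i).
rewrite -[y i](divfK (lt0r_neq0 M0)) -/(w i) exprMn mulrC; apply: ler_wpM2l; first by rewrite exprn_ge0// ltW.
(* As [w i <= 1], a positive exponent may be lowered to 1. *)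
by case: (m (s i)) mi => // k _; rewrite exprS ler_piMr// exprn_ile1.
Qed.
End quotient_bound.

(** * Bound on the squared quotient by powers of the gaps *)

Section quotient_gap.
Variables (R : realType) (N r : nat).
Implicit Types (y : nat -> R) (x : 'rV[R]_N) (f : mpoly.mpoly N R[i]).

Local Notation normc := ComplexField.Normc.normc.

Lemma powR_prod_nat (F : nat -> R) p n : (forall i, (i < n)%N -> 0 <= F i) ->
  (\prod_(0 <= i < n) F i) `^ p = \prod_(0 <= i < n) F i `^ p.
Proof.
elim: n => [|n IH] F0; first by rewrite !big_geq// powR1.
rewrite !big_nat_recr//= powRM ?F0//; last first.
  by apply: prodr_nat_ge0 => i /andP[_ /ltnW]; exact: F0.
by rewrite IH// => i /ltnW; exact: F0.
Qed.

(** Raising to the power [2 * r] makes all exponents integers: the denominator becomes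
    [vandermonde_sq y N], and [prod_gap_le_vandermonde_sq] applies. *)
Lemma quotient_fun_gap_bound f (M : R) : ideal_J r f ->
  (0 < r)%N -> (r < N)%N -> (N < 2 * r)%N -> 1 <= M ->
  exists2 K : R, 0 <= K & forall x y (s : 'S_N),
    (forall i, `|x ord0 i| <= M) -> (forall i, x ord0 i != 0) ->
    (forall i : 'I_N, y i = `|x ord0 (s i)|) ->
    (forall k, (k < N)%N -> 0 <= gap y k) ->
    normc (quotient_fun r f x) ^+ 2 <=
    K * \prod_(0 <= k < N) gap y k `^ ((2 * r)%:R^-1 - 1).
Proof.
move=> fJ r0 rN N2r M1; have M0 : 0 <= M by exact: le_trans M1.
have [C C0 fC] := ideal_J_bound fJ rN M1.
have [A A1 HA] := @prod_gap_le_vandermonde_sq R r N N2r.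
have A0 : 0 <= A by exact: le_trans A1.
pose B := C ^+ (4 * r) * (A * M ^+ excess r N).
have B0 : 0 <= B by rewrite !mulr_ge0 ?exprn_ge0.
(* [B <= (1 + B) ^+ (2 * r)], so no root of [B] has to be taken. *)
exists (1 + B); first by rewrite addr_ge0.
move=> x y s xM x0 yx y0.
have r2 : (2 * r)%:R != 0 :> R by rewrite pnatr_eq0 muln_eq0 -lt0n r0.
set b := (2 * r)%:R^-1.
pose W := \prod_(i < N) \prod_(j < N | (i < j)%N) `|x ord0 i ^+ 2 - x ord0 j ^+ 2| `^ b.
have W0 : 0 <= W by apply: prodr_ge0 => i _; apply: prodr_ge0 => j _; exact: powR_ge0.
have -> : normc (quotient_fun r f x) = normc (mpoly.meval (fun i => (x ord0 i)%:C%C) f) / W.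
  by rewrite ComplexField.Normc.normcM ComplexField.Normc.normcV normc_real ger0_norm.
set F := normc _.
have F0 : 0 <= F by exact: normc_ge0.
have G0 : 0 <= \prod_(0 <= k < N) gap y k `^ (b - 1).
  by apply: prodr_nat_ge0 => k _; exact: powR_ge0.
(* Where the denominator vanishes, the quotient is 0 by the convention on inverses. *)
have [->|Wn0] := eqVneq W 0.
  by rewrite invr0 mulr0 expr0n /= mulr_ge0// addr_ge0.
have WV : W ^+ (4 * r) = vandermonde_sq y N.
  rewrite vandermonde_sqE.
  under eq_bigr do under eq_bigr do rewrite !yx !real_normK ?num_real//.
  rewrite (prod_sub_sqr_perm (fun i => x ord0 i ^+ 2)).
  rewrite (_ : 4 * r = 2 * r * 2)%N; last by rewrite mulnAC.
  rewrite exprM -[RHS]real_normK ?num_real//; congr (_ ^+ 2).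
  rewrite normr_prod -prodrXl; apply: eq_bigr => i _.
  rewrite normr_prod -prodrXl; apply: eq_bigr => j _.
  by rewrite -[LHS]powR_mulrn ?powR_ge0// -powRrM mulVf// powRr1// distrC.
have V0 : 0 < vandermonde_sq y N by rewrite -WV exprn_gt0// lt_def Wn0.
(* A zero gap would mean a zero coordinate or two equal absolute values, and the latter forces
   [W = 0]. *)
have gap_gt0 k : (k < N)%N -> 0 < gap y k.
  move=> kN; rewrite lt_def y0// andbT; apply/eqP => gk.
  case: k => [|k] in kN gk.
    by move: gk; rewrite /gap (yx (Ordinal kN)) => /normr0P; rewrite (negPf (x0 _)).
  move: V0; rewrite vandermonde_sqE (bigD1 (Ordinal (ltnW kN)))//=.
  rewrite (bigD1 (Ordinal kN))//=.
  by move/eqP: gk; rewrite /gap subr_eq0 => /eqP ->; rewrite subrr !mul0r expr0n ltxx.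
rewrite -powR_prod_nat//; set G := \prod_(0 <= k < N) gap y k.
have Gp : 0 < G by rewrite /G big_nat; apply: prodr_gt0 => i; exact: gap_gt0.
have := HA N y M (leqnn N) y0 _ M0.
have yM k : (k < N)%N -> y k <= M by move=> kN; rewrite (yx (Ordinal kN)).
move=> /(_ yM); rewrite -/G; set P := \prod_(r <= i < N) _ => ineq.
have yi0 i : (i < N)%N -> 0 <= y i by move=> iN; rewrite (yx (Ordinal iN)).
have FP : F ^+ (4 * r) <= C ^+ (4 * r) * P.
  rewrite /P prodrXl -exprMn lerXn2r ?nnegrE//; last exact: fC xM yx y0.
  by rewrite mulr_ge0//; apply: prodr_nat_ge0 => i /andP[_ /yi0].
have r20 : (0 < 2 * r)%N by rewrite muln_gt0.
rewrite -(@ler_pXn2r _ (2 * r)) ?nnegrE ?mulr_ge0 ?exprn_ge0 ?divr_ge0 ?invr_ge0 ?addr_ge0 ?powR_ge0//.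
rewrite -exprM mulnA exprMn exprVn -/(4 * r)%N WV ler_pdivrMr// exprMn.
rewrite -[X in _ * X * _]powR_mulrn ?powR_ge0// -powRrM mulrBl mul1r mulVf//.
have -> : G `^ (1 - (2 * r)%:R) = (G ^+ (2 * r).-1)^-1.
  rewrite -powR_invn; last exact: ltW.
  by congr powR; rewrite -opprB -[in LHS](prednK r20) -natr1 addrK.
rewrite mulrAC ler_pdivlMr ?exprn_gt0//.
apply: (@le_trans _ _ (C ^+ (4 * r) * P * G ^+ (2 * r).-1)).
  by apply: ler_wpM2r => //; rewrite exprn_ge0// ltW.
rewrite -mulrA; apply: (@le_trans _ _ (B * vandermonde_sq y N)).
  by rewrite /B -mulrA; apply: ler_wpM2l => //; exact: exprn_ge0.
apply: ler_wpM2r; first exact: ltW.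
apply: (@le_trans _ _ (1 + B)); first by rewrite lerDr.
by rewrite -[leLHS]expr1; apply: ler_weXn2l => //; rewrite lerDl.
Qed.
End quotient_gap.

(** * Products of gap powers along a list, and deletion of an entry *)

Section chains.
Variables (R : realType) (p : R).
Hypothesis p01 : -1 <= p <= 0.

Fixpoint chain (a : R) (s : seq R) : R :=
  if s is b :: s' then `|b - a| `^ p * chain b s' else 1.

Lemma chain_ge0 a s : 0 <= chain a s.
Proof. by elim: s a => //= b s IH a; rewrite mulr_ge0 ?powR_ge0. Qed.

Lemma chainE a s : chain a s =
  \prod_(0 <= k < size s) `|nth 0 s k - nth 0 (a :: s) k| `^ p.
Proof.
elim: s a => [|b s IH] a; first by rewrite big_geq.
by rewrite [LHS]/= IH /= big_nat_recl.
Qed.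

Lemma le0_ler_powR (u v : R) : 0 < u -> u <= v -> v `^ p <= u `^ p.
Proof.
move=> u0 uv; have /andP[_ p0] := p01; have v0 : 0 < v by exact: lt_le_trans uv.
rewrite -[p]opprK (powRN v (- p)) (powRN u (- p)) lef_pV2 ?posrE ?powR_gt0//.
by apply: ge0_ler_powR; rewrite ?oppr_ge0// nnegrE ltW.
Qed.

(* The larger of u and v is at least (u + v) / 2. *)
Lemma powR_gap_split (u v : R) : 0 < u -> 0 < v ->
  u `^ p * v `^ p <= 2 * (u `^ p + v `^ p) * (u + v) `^ p.
Proof.
wlog uv : u v / u <= v => [hw u0 v0|u0 v0].
  have [uv|/ltW vu] := leP u v; first exact: hw.
  by rewrite mulrC addrC (addrC u); exact: hw.
have h : v `^ p <= 2 * (u + v) `^ p.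
  apply: (@le_trans _ _ (((u + v) / 2) `^ p)).
    by apply: le0_ler_powR; [rewrite divr_gt0// addr_gt0|lra].
  have uv0 : 0 <= u + v by rewrite addr_ge0 ?ltW.
  rewrite powRM ?invr_ge0// [leLHS]mulrC; apply: ler_wpM2r; first exact: powR_ge0.
  rewrite -powR_inv1// -powRrM mulN1r -[leRHS]powRr1//.
  by apply: ler_powR; [lra|have /andP[] := p01; lra].
rewrite -mulrA mulrCA; apply: ler_pM; rewrite ?powR_ge0//.
by rewrite lerDl powR_ge0.
Qed.

(** Deleting [t] merges its two gaps, as in [powR_gap_split]. Summing over all entries instead of
    the neighbours makes the cost independent of the position of [t]. *)
Lemma chain_insert a s1 t s2 : path <%R a (s1 ++ t :: s2) ->
  chain a (s1 ++ t :: s2) <=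
  2 * (\sum_(b <- a :: s1 ++ s2) `|t - b| `^ p) * chain a (s1 ++ s2).
Proof.
have sum_ge0 (s : seq R) : 0 <= \sum_(b <- s) `|t - b| `^ p.
  by apply: sumr_ge0 => b _; exact: powR_ge0.
elim: s1 a => [|c s1 IH] a.
  rewrite !cat0s big_cons; case: s2 => [|b s2] /= /andP[ta].
    by rewrite big_nil addr0 !mulr1 ler_peMl ?powR_ge0// ler1n.
  move=> /andP[bt _]; rewrite big_cons !mulrA; apply: ler_wpM2r; first exact: chain_ge0.
  have t_a : 0 < t - a by rewrite subr_gt0.
  have b_t : 0 < b - t by rewrite subr_gt0.
  have b_a : 0 < b - a by rewrite subr_gt0 (lt_trans ta).
  rewrite (distrC t b) !gtr0_norm// addrA.
  apply: le_trans (powR_gap_split t_a b_t) _.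
  rewrite (_ : t - a + (b - t) = b - a); last by ring.
  apply: ler_wpM2r; first exact: powR_ge0.
  by apply: ler_wpM2l => //; rewrite lerDl.
rewrite !cat_cons big_cons /= => /andP[_ /IH {}IH].
rewrite mulrCA; apply: ler_wpM2l; first exact: powR_ge0.
apply: le_trans IH _; apply: ler_wpM2r; first exact: chain_ge0.
by apply: ler_wpM2l => //; rewrite lerDr powR_ge0.
Qed.

Variable M : R.

(** The cost in [chain_insert] of placing [|t|] among 0 and the [|v ord0 j|], cut off so that it is
    integrable over the whole line. *)
Definition link n (t : R) (v : 'rV[R]_n) : R :=
  (`|t| <= M)%R%:R * (`|t| `^ p + \sum_(j < n) `| `|t| - `|v ord0 j| | `^ p).

(* The first coordinate enters only through [link], so Tonelli integrates it out
   first although it may sit anywhere in the sorted order. *)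
Fixpoint chain_bound n : 'rV[R]_n -> R :=
  match n with
  | 0 => fun=> 1
  | n'.+1 => fun x => 2 * link (uncons_rV x).1 (uncons_rV x).2 *
      @chain_bound n' (uncons_rV x).2
  end.

Lemma link_ge0 n t (v : 'rV[R]_n) : 0 <= link t v.
Proof.
rewrite mulr_ge0// addr_ge0 ?powR_ge0//.
by apply: sumr_ge0 => j _; exact: powR_ge0.
Qed.

Lemma chain_bound_ge0 n (x : 'rV[R]_n) : 0 <= chain_bound x.
Proof. by elim: n x => [|n IH] x //=; rewrite mulr_ge0// mulr_ge0// link_ge0. Qed.

(** Induction on [n]: [chain_insert] deletes the absolute value of the first coordinate wherever it
    sits in [s], and the rest of [s] lists the other coordinates. *)
Lemma chain_le_chain_bound n (x : 'rV[R]_n) (s : seq R) :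
  (forall i, `|x ord0 i| <= M) -> perm_eq s [seq `|x ord0 i| | i <- enum 'I_n] ->
  path <%R 0 s -> chain 0 s <= chain_bound x.
Proof.
elim: n x s => [|n IH] x s xM.
  have -> : enum 'I_0 = [::] by apply: size0nil; rewrite -cardE card_ord.
  by move/perm_size/size0nil => ->.
rewrite enum_ordSl [map _ _]/=; set t := `|x ord0 ord0|; rewrite -map_comp => sx.
have := perm_mem sx t; rewrite mem_head => ts.
case/splitPr: ts sx => s1 s2.
rewrite perm_catC cat_cons perm_cons perm_catC => sx spath.
have path12 : path <%R 0 (s1 ++ s2).
  apply: subseq_path spath; first exact: lt_trans.
  by apply: cat_subseq => //; exact: subseq_cons.
apply: le_trans (chain_insert spath) _ => /=; apply: ler_pM.
- by rewrite mulr_ge0//; apply: sumr_ge0 => b _; exact: powR_ge0.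
- exact: chain_ge0.
- apply: ler_wpM2l => //; rewrite /link xM mul1r big_cons subr0 normr_id lerD2l.
  rewrite (perm_big _ sx) big_map -big_enum /=.
  by apply: ler_sum => j _; rewrite mxE.
apply: IH => // [i|]; first by rewrite mxE.
apply: perm_trans sx _; rewrite perm_sym.
by under eq_map do rewrite mxE.
Qed.

End chains.

(** * Uniform integrability of a power singularity *)

Section power_integral.
Variables (R : realType) (p : R).
Hypothesis p01 : -1 < p <= 0.

Let p01' : -1 <= p <= 0.
Proof. by have /andP[/ltW -> ->] := p01. Qed.

(** This is where [-1 < p] enters: it makes the geometric series of dyadic contributions
    converge. *)
Lemma powR2_lt2 : (2 : R) `^ (- p) < 2.
Proof.
have /andP[p1 p0] := p01.
have p2 : 1 < (2 : R) `^ (1 + p).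
  rewrite -[ltLHS](_ : 1 `^ (1 + p) = 1); last by rewrite powR1.
  by apply: gt0_ltr_powR; rewrite ?nnegrE ?ltr1n//; lra.
have e2 : (2 : R) `^ (1 + p) * 2 `^ (- p) = 2.
  by rewrite -powRD ?pnatr_eq0 ?implybT// addrK powRr1.
by rewrite -[ltRHS]e2 ltr_pMl// powR_gt0.
Qed.

Lemma dyadic_shell (u : R) : 0 < u <= 1 ->
  exists m, 2^-1 ^+ m.+1 < u <= 2^-1 ^+ m.
Proof.
move=> /andP[u0 u1].
have ex : exists m, 2^-1 ^+ m < u.
  have [m um] : exists m : nat, u^-1 < m%:R.
    by exists (Num.truncn u^-1).+1; rewrite truncnS_gt.
  exists m; rewrite exprVn -[ltRHS]invrK ltf_pV2 ?posrE ?invr_gt0 ?exprn_gt0//.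
  by apply: lt_trans um _; rewrite -natrX ltr_nat ltn_expl.
case: (ex_minnP ex) => -[|m] um mmin.
  by move: um; rewrite expr0 ltNge u1.
exists m; rewrite um/= leNgt; apply/negP => /mmin.
by rewrite ltnn.
Qed.

Local Open Scope classical_set_scope.

(** A full interval rather than an annulus, which suffices for an upper bound. *)
Let shell (a : R) m : set R := `[a - 2^-1 ^+ m, a + 2^-1 ^+ m].

Let shellE a m (t : R) : shell a m t = (`|t - a| <= 2^-1 ^+ m).
Proof. by rewrite /shell/= in_itv/= ler_distl. Qed.

Let lebesgue_shell a m : lebesgue_measure (shell a m) = (2 * 2^-1 ^+ m)%:E.
Proof.
have h : 0 < 2^-1 ^+ m :> R by rewrite exprn_gt0// invr_gt0.
rewrite /shell lebesgue_measure_itv/= lte_fin ltrD2l gtrN// -EFinB; congr EFin; ring.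
Qed.

(** The coefficient bounds the power on the dyadic range [m]. Two centres are used because the
    distance from [|t|] to [|a|] is that from [t] to [|a|] or to [- |a|], according to the sign of
    [t]. *)
Let term (a : R) m (t : R) : R :=
  (2 `^ (- p)) ^+ m.+1 * (\1_(shell `|a| m) t + \1_(shell (- `|a|) m) t).

Let term_ge0 a m t : 0 <= term a m t.
Proof. by rewrite /term mulr_ge0 ?exprn_ge0 ?powR_ge0// addr_ge0// indicE. Qed.

Let measurable_term a m : measurable_fun setT (term a m).
Proof.
apply: measurable_funM => //; apply: measurable_funD;
  by apply: measurable_indic; exact: measurable_itv.
Qed.

Lemma powR_le_series (M a t : R) :
  ((((`|t| <= M)%R%:R * `| `|t| - `|a| | `^ p)%R)%:E <=
   (\1_(`[- M, M] : set R) t)%:E + \sum_(0 <= m <oo) (term a m t)%:E)%E.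
Proof.
have S0 : (0 <= \sum_(0 <= m <oo) (term a m t)%:E)%E.
  by apply: nneseries_ge0 => m _ _; rewrite lee_fin.
have -> : \1_(`[- M, M] : set R) t = (`|t| <= M)%R%:R :> R.
  by rewrite indicE mem_setE in_itv/= ler_norml.
have [_|_] := leP `|t| M; last by rewrite mulr0n mul0r add0e.
rewrite mulr1n mul1r; set u := `| _ - _ |.
(* At 0 the power is 0 by convention, or 1 if [p = 0]; the indicator covers both. *)
have [->|u0] := eqVneq u 0.
  rewrite (@le_trans _ _ 1%:E)// ?leeDl// lee_fin /powR eqxx.
  by case: (p == 0).
have {}u0 : 0 < u by rewrite lt_def u0 normr_ge0.
have [u1|/ltW u1] := leP u 1; last first.
  rewrite (@le_trans _ _ 1%:E)// ?leeDl// lee_fin -[leRHS](powRr0 u).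
  by apply: ler_powR => //; have /andP[] := p01.
have [|m /andP[mu um]] := @dyadic_shell u; first by rewrite u0.
apply: (@le_trans _ _ (term a m t)%:E).
  rewrite lee_fin; apply: (@le_trans _ _ ((2 `^ (- p)) ^+ m.+1)).
    have d0 : 0 < 2^-1 ^+ m.+1 :> R by rewrite exprn_gt0// invr_gt0.
    apply: le_trans (le0_ler_powR p01' d0 (ltW mu)) _.
    rewrite -powR_mulrn// powRAC powR_mulrn ?powR_ge0//.
    by rewrite exprVn -powR_inv1 ?exprn_ge0// -powRrM mulN1r.
  rewrite /term ler_peMr ?exprn_ge0 ?powR_ge0//.
  have [t0|t0] := leP 0 t.
    rewrite -[leLHS]addr0; apply: lerD; last by rewrite indicE.
    by rewrite indicE mem_set// shellE -{1}(ger0_norm t0).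
  rewrite addrC -[leLHS]addr0; apply: lerD; last by rewrite indicE.
  rewrite indicE mem_set// shellE opprK; apply: le_trans um.
  by rewrite /u (ltr0_norm t0) -[leRHS]normrN opprB opprK addrC.
apply: (@le_trans _ _ (\sum_(0 <= m <oo) (term a m t)%:E)%E); last by rewrite leeDr ?lee_fin.
apply: le_trans (nneseries_lim_ge m.+1 _); last by move=> k _ _; rewrite lee_fin.
by rewrite big_nat_recr//= leeDr// sume_ge0// => k _; rewrite lee_fin.
Qed.

Lemma measurable_cutoff_powR d (T : measurableType d) (M : R) (f g : T -> R) :
  measurable_fun setT f -> measurable_fun setT g ->
  measurable_fun setT (fun z => (`|f z| <= M)%R%:R * `| `|f z| - `|g z| | `^ p).
Proof.
move=> mf mg.
have mnf : measurable_fun setT (fun z => `|f z|) by exact: measurableT_comp.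
have mng : measurable_fun setT (fun z => `|g z|) by exact: measurableT_comp.
apply: measurable_funM.
  rewrite (_ : (fun z => _) = (fun z => if `|f z| <= M then 1 else 0)).
    by apply: measurable_fun_ifT => //; exact: measurable_fun_ler.
  by apply/funext => z; case: ifP.
apply: (measurableT_comp (measurable_powR p)).
by apply: measurableT_comp => //; exact: measurable_funB.
Qed.

(** The length of a shell does not depend on its centre, so every [term] has an integral independent
    of [a]. *)
Lemma integral_powR_le (M : R) : exists K : R, forall a : R,
  (\int[lebesgue_measure]_(t in setT)
     (((`|t| <= M)%R%:R * `| `|t| - `|a| | `^ p)%R)%:E <= K%:E)%E.
Proof.
have q2 := powR2_lt2; set q := 2 `^ (- p) in q2.
have q0 : 0 <= q by exact: powR_ge0.
(* The sum of the geometric series of the integrals [4 * q * (q / 2) ^+ k]. *)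
pose K := 4 * q / (1 - q / 2).
pose I : set R := `[- M, M].
have I0 : (lebesgue_measure I < +oo)%E.
  by rewrite /I lebesgue_measure_itv/=; case: ifP => // _; rewrite -EFinB ltry.
exists (fine (lebesgue_measure I) + K) => a.
have meas : measurable_fun setT (fun t : R => (`|t| <= M)%R%:R * `| `|t| - `|a| | `^ p).
  exact: measurable_cutoff_powR.
have mI : measurable_fun setT (fun t : R => (\1_I t : R)%:E).
  by apply/measurable_EFinP; apply: measurable_indic; exact: measurable_itv.
have mT k : measurable_fun setT (fun t => (term a k t)%:E).
  exact/measurable_EFinP.
have mS : measurable_fun setT (fun t => \sum_(0 <= m <oo) (term a m t)%:E)%E.
  apply: (@ge0_emeasurable_sum _ _ _ _ (fun m t => (term a m t)%:E) predT) => // k x _ _.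
  by rewrite lee_fin.
apply: (@le_trans _ _ (\int[lebesgue_measure]_(t in setT)
    ((\1_I t)%:E + \sum_(0 <= m <oo) (term a m t)%:E))%E).
  apply: ge0_le_integral => //.
  - exact/measurable_EFinP.
  - exact: emeasurable_funD.
  - by move=> t _; exact: powR_le_series.
rewrite ge0_integralD//; last first.
- by move=> t _; apply: nneseries_ge0 => m _ _; rewrite lee_fin.
rewrite integral_indic//=; last exact: measurable_itv.
rewrite setIT EFinD fineK ?ge0_fin_numE//.
apply: leeD => //.
rewrite integral_nneseries//; last by move=> k t _; rewrite lee_fin.
apply: lime_le; first by apply: is_cvg_nneseries => k _ _; apply: integral_ge0 => t _; rewrite lee_fin.
apply: nearW => n.
have int_term k : (\int[lebesgue_measure]_t (term a k t)%:E = (4 * q * (q / 2) ^+ k)%:E)%E.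
  rewrite /term -/q; under eq_integral do rewrite EFinM EFinD.
  rewrite ge0_integralZl_EFin ?exprn_ge0//; last 2 first.
  - by move=> t _; rewrite adde_ge0// lee_fin indicE.
  - by apply: emeasurable_funD; apply/measurable_EFinP; apply: measurable_indic; exact: measurable_itv.
  rewrite ge0_integralD//; try by move=> t _; rewrite lee_fin indicE.
  - rewrite !integral_indic//=; try exact: measurable_itv.
    rewrite !setIT; rewrite !lebesgue_shell -EFinD -EFinM; congr EFin.
    by rewrite exprS expr_div_n exprVn; ring.
  - by apply/measurable_EFinP; apply: measurable_indic; exact: measurable_itv.
  - by apply/measurable_EFinP; apply: measurable_indic; exact: measurable_itv.
under eq_bigr do rewrite int_term.
rewrite sumEFin lee_fin.
have z1 : q / 2 != 1 by rewrite lt_eqF// ltr_pdivrMr// mul1r.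
have := congr1 (fun f => f n) (geometric_seriesE (4 * q) z1).
rewrite /series/= => ->; rewrite /K ler_pM2r; last first.
  by rewrite invr_gt0 subr_gt0 ltr_pdivrMr// mul1r.
by rewrite ler_piMr ?mulr_ge0// gerBl exprn_ge0// divr_ge0.
Qed.

End power_integral.

(** * Integrability of the iterated bound by Tonelli *)

Section chain_bound_integral.
Variables (R : realType) (p M : R).
Hypothesis p01 : -1 < p <= 0.
Local Open Scope classical_set_scope.

(** Reading [|t|] as its distance to [|0|] gives every summand the form treated by
    [integral_powR_le]. *)
Lemma link_cutoff (t : R) n (v : 'rV[R]_n) : link p M t v =
  (`|t| <= M)%R%:R * `| `|t| - `|0 : R| | `^ p +
  \sum_(j < n) (`|t| <= M)%R%:R * `| `|t| - `|v ord0 j| | `^ p.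
Proof. by rewrite /link normr0 subr0 normr_id mulrDr mulr_sumr. Qed.

Lemma measurable_link d (T : measurableType d) n (f : T -> R) (g : T -> 'rV[R]_n) :
  measurable_fun setT f -> measurable_fun setT g ->
  measurable_fun setT (fun z => link p M (f z) (g z)).
Proof.
move=> mf mg; under eq_fun do rewrite link_cutoff.
apply: measurable_funD; first exact: (measurable_cutoff_powR p M mf (measurable_cst (0 : R))).
apply: measurable_sum => j.
apply: (measurable_cutoff_powR p M mf).
exact: (measurableT_comp (measurable_coord j) mg).
Qed.

Lemma measurable_chain_bound n : measurable_fun setT (@chain_bound R p M n).
Proof.
elim: n => [|n IH] /=; first exact: measurable_cst.
have m1 : measurable_fun setT (fun x : 'rV[R]_n.+1 => (uncons_rV x).1).
  exact: (measurableT_comp measurable_fst (@measurable_uncons_rV R n)).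
have m2 : measurable_fun setT (fun x : 'rV[R]_n.+1 => (uncons_rV x).2).
  exact: (measurableT_comp measurable_snd (@measurable_uncons_rV R n)).
apply: measurable_funM; last exact: (measurableT_comp IH m2).
by apply: measurable_funM => //; exact: measurable_link.
Qed.

Lemma chain_bound_cons n (t : R) (v : 'rV[R]_n) :
  chain_bound p M (cons_rV (t, v)) = 2 * link p M t v * chain_bound p M v.
Proof.
have -> x : @chain_bound R p M n.+1 x = 2 * link p M (uncons_rV x).1 (uncons_rV x).2 *
  chain_bound p M (uncons_rV x).2 by [].
by rewrite cons_rVK.
Qed.

Lemma integral_link : exists K : R, 0 <= K /\ forall n (v : 'rV[R]_n),
  (\int[lebesgue_measure]_(t in setT) (link p M t v)%:E <= (K *+ n.+1)%:E)%E.
Proof.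
have [K HK] := integral_powR_le p01 M.
have K0 : 0 <= K.
  rewrite -lee_fin; apply: le_trans (HK 0); apply: integral_ge0 => t _.
  by rewrite lee_fin mulr_ge0 ?powR_ge0.
exists K; split => // n v.
have ge0 (a t : R) : (0 <= ((`|t| <= M)%R%:R * `| `|t| - `|a| | `^ p)%:E)%E.
  by rewrite lee_fin mulr_ge0 ?powR_ge0.
have meas (a : R) : measurable_fun [set: measurableTypeR R]
    (fun t : R => ((`|t| <= M)%R%:R * `| `|t| - `|a| | `^ p)%:E).
  by apply/measurable_EFinP; exact: measurable_cutoff_powR.
under eq_integral do rewrite link_cutoff EFinD -sumEFin.
rewrite ge0_integralD//; last 2 first.
- by move=> t _; exact: sume_ge0.
- exact: emeasurable_sum.
rewrite mulrS EFinD; apply: leeD; first exact: HK.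
rewrite ge0_integral_sum//.
apply: (@le_trans _ _ (\sum_(j < n) K%:E)%E); first by apply: lee_sum => j _; exact: HK.
by rewrite sumEFin sumr_const card_ord.
Qed.

Lemma integral_chain_bound_lty n :
  (\int[@lebesgue_rV R n]_(x in setT) (chain_bound p M x)%:E < +oo)%E.
Proof.
have [K [K0 HK]] := integral_link.
elim: n => [|n IH].
  rewrite /lebesgue_rV integral_dirac//=.
  by rewrite diracE -EFinM ltry.
have mG : measurable_fun setT (fun x : 'rV[R]_n.+1 => (chain_bound p M x)%:E).
  by apply/measurable_EFinP; exact: measurable_chain_bound.
have mcb := @measurable_chain_bound n.
rewrite [X in (X < _)%E](_ : _ =
   \int[pushforward (lebesgue_measure \x @lebesgue_rV R n)%E (@cons_rV R n)]_(x in setT)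
     (chain_bound p M x)%:E)%E//.
rewrite (ge0_integral_pushforward (@measurable_cons_rV R n))//; last first.
  by move=> x _; rewrite lee_fin chain_bound_ge0.
(* The first coordinate is integrated innermost, with a bound uniform in the others, which leaves a
   multiple of the integral in dimension [n]. *)
rewrite preimage_setT fubini_tonelli2; last 2 first.
- exact: (measurableT_comp mG (@measurable_cons_rV R n)).
- by move=> z; exact: chain_bound_ge0.
apply: (@le_lt_trans _ _ (\int[@lebesgue_rV R n]_(v in setT)
    ((2 * (K *+ n.+1))%:E * (chain_bound p M v)%:E))%E); last first.
  rewrite ge0_integralZl_EFin ?mulr_ge0 ?mulrn_wge0//.
  - by rewrite lte_mul_pinfty// ?lee_fin ?mulr_ge0 ?mulrn_wge0.
  - by move=> v _; rewrite lee_fin chain_bound_ge0.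
  - exact/measurable_EFinP.
apply: ge0_le_integral => //.
- by move=> v _; apply: integral_ge0 => t _; rewrite lee_fin; exact: chain_bound_ge0.
- apply: measurable_fun_fubini_tonelli_G; last by move=> z; exact: chain_bound_ge0.
  exact: (measurableT_comp mG (@measurable_cons_rV R n)).
- by apply: emeasurable_funM => //; exact/measurable_EFinP.
move=> v _; rewrite /fubini_G.
rewrite [leLHS](_ : _ = \int[lebesgue_measure]_(t in setT)
    ((2 * chain_bound p M v)%:E * (link p M t v)%:E))%E; last first.
  by apply: eq_integral => t _; rewrite -EFinM mulrAC -chain_bound_cons.
rewrite ge0_integralZl_EFin//; last 3 first.
- by move=> t _; rewrite lee_fin link_ge0.
- by apply/measurable_EFinP; exact: measurable_link.
- by rewrite mulr_ge0// chain_bound_ge0.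
rewrite [leRHS](_ : _ = (2 * chain_bound p M v)%:E * (K *+ n.+1)%:E)%E; last first.
  by rewrite -!EFinM mulrAC.
apply: lee_wpmul2l; last exact: HK.
by rewrite lee_fin mulr_ge0// chain_bound_ge0.
Qed.

End chain_bound_integral.

(** * Measurability of complex-valued functions *)

Section measurability.
Variables (R : realType) (d : measure_display) (T : measurableType d).
Local Open Scope classical_set_scope.
Implicit Types F G : T -> R[i].

Definition cmeasurable F :=
  measurable_fun setT (fun x => complex.Re (F x)) /\
  measurable_fun setT (fun x => complex.Im (F x)).

Lemma cmeasurable_cst (c : R[i]) : cmeasurable (fun=> c).
Proof. by split; exact: measurable_cst. Qed.

Lemma cmeasurable_real (g : T -> R) :
  measurable_fun setT g -> cmeasurable (fun x => ((g x)%:C)%C).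
Proof. by move=> mg; split => //=; exact: measurable_cst. Qed.

Lemma cmeasurableM F G : cmeasurable F -> cmeasurable G ->
  cmeasurable (fun x => F x * G x).
Proof.
move=> [F1 F2] [G1 G2]; split.
  rewrite (_ : (fun x => _) = (fun x => complex.Re (F x) * complex.Re (G x) -
    complex.Im (F x) * complex.Im (G x))).
    by apply: measurable_funB; exact: measurable_funM.
  by apply/funext => x; case: (F x); case: (G x).
rewrite (_ : (fun x => _) = (fun x => complex.Re (F x) * complex.Im (G x) +
  complex.Im (F x) * complex.Re (G x))).
  by apply: measurable_funD; exact: measurable_funM.
by apply/funext => x; case: (F x); case: (G x).
Qed.

Lemma cmeasurableD F G : cmeasurable F -> cmeasurable G ->
  cmeasurable (fun x => F x + G x).
Proof.
move=> [F1 F2] [G1 G2]; split.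
  rewrite (_ : (fun x => _) = (fun x => complex.Re (F x) + complex.Re (G x))).
    exact: measurable_funD.
  by apply/funext => x; case: (F x); case: (G x).
rewrite (_ : (fun x => _) = (fun x => complex.Im (F x) + complex.Im (G x))).
  exact: measurable_funD.
by apply/funext => x; case: (F x); case: (G x).
Qed.

Lemma cmeasurable_sum (I : Type) (s : seq I) (F : I -> T -> R[i]) :
  (forall i, cmeasurable (F i)) -> cmeasurable (fun x => \sum_(i <- s) F i x).
Proof.
move=> mF; elim: s => [|i s IH].
  by under eq_fun do rewrite big_nil; exact: cmeasurable_cst.
by under eq_fun do rewrite big_cons; exact: cmeasurableD.
Qed.

Lemma cmeasurable_prod (I : Type) (s : seq I) (F : I -> T -> R[i]) :
  (forall i, cmeasurable (F i)) -> cmeasurable (fun x => \prod_(i <- s) F i x).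
Proof.
move=> mF; elim: s => [|i s IH].
  by under eq_fun do rewrite big_nil; exact: cmeasurable_cst.
by under eq_fun do rewrite big_cons; exact: cmeasurableM.
Qed.

Lemma cmeasurableX F n : cmeasurable F -> cmeasurable (fun x => F x ^+ n).
Proof.
move=> mF; elim: n => [|n IH].
  by under eq_fun do rewrite expr0; exact: cmeasurable_cst.
by under eq_fun do rewrite exprS; exact: cmeasurableM.
Qed.

Lemma measurable_normc F : cmeasurable F ->
  measurable_fun setT (fun x => ComplexField.Normc.normc (F x) ^+ 2).
Proof.
move=> [F1 F2].
rewrite (_ : (fun x => _) = (fun x => complex.Re (F x) ^+ 2 + complex.Im (F x) ^+ 2)).
  by apply: measurable_funD; exact: measurable_funX.
by apply/funext => x; case: (F x) => a b /=; rewrite sqr_sqrtr// addr_ge0 ?sqr_ge0.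
Qed.

End measurability.

(** * Measurability of the quotient *)

Section quotient_measurable.
Variables (R : realType) (N r : nat) (f : mpoly.mpoly N R[i]).
Local Open Scope classical_set_scope.

Lemma cmeasurable_quotient_fun : cmeasurable (@quotient_fun R N r f).
Proof.
rewrite /quotient_fun; apply: cmeasurableM.
  under eq_fun do rewrite mpoly.mevalE.
  apply: cmeasurable_sum => m; apply: cmeasurableM; first exact: cmeasurable_cst.
  apply: cmeasurable_prod => i; apply: cmeasurableX.
  by apply: cmeasurable_real; exact: measurable_coord.
under eq_fun do rewrite -fmorphV/=.
apply: cmeasurable_real.
pose W (x : 'rV[R]_N) := \prod_(i < N) \prod_(j < N | (i < j)%N)
     `|x ord0 i ^+ 2 - x ord0 j ^+ 2| `^ (2 * r)%:R^-1.
have mW : measurable_fun setT W.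
  apply: measurable_prod => i _.
  rewrite (_ : (fun x => _) = (fun x : 'rV[R]_N => \prod_(j < N) if (i < j)%N then
      `|x ord0 i ^+ 2 - x ord0 j ^+ 2| `^ (2 * r)%:R^-1 else 1)); last first.
    by apply/funext => x; rewrite big_mkcond.
  apply: measurable_prod => j _; case: (i < j)%N; last exact: measurable_cst.
  apply: (measurableT_comp (measurable_powR _)).
  apply: measurableT_comp => //; apply: measurable_funB; apply: measurable_funX;
    exact: measurable_coord.
(* Since [W] is nonnegative, its inverse is a real power, also where [W] is 0. *)
rewrite (_ : (fun x => _) = (fun x => W x `^ (-1))).
  exact: (measurableT_comp (measurable_powR _)).
apply/funext => x; rewrite powR_inv1//.
by apply: prodr_ge0 => i _; apply: prodr_ge0 => j _; exact: powR_ge0.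
Qed.

End quotient_measurable.

(** * The pointwise bound off the coordinate hyperplanes *)

Section local_integrability.
Variables (R : realType) (N r : nat).
Local Open Scope classical_set_scope.

(** Each coordinate hyperplane is a rectangle with one side [[set 0]], of length 0; the product is 0
    although the other sides are infinite. *)
Lemma lebesgue_rV_coord0 : exists Z : set 'rV[R]_N,
  [/\ measurable Z, lebesgue_rV N Z = 0%E &
      forall x, ~ Z x -> forall i, x ord0 i != 0].
Proof.
pose Zi (i : 'I_N) := [set x : 'rV[R]_N | x ord0 i = 0].
have ZiE i : Zi i = [set x | forall j, (if j == i then [set 0 : R] else setT) (x ord0 j)].
  apply/seteqP; split => [x Zx j|x /(_ i)]; last by rewrite eqxx.
  by case: eqP => // ->.
have mI i (j : 'I_N) : measurable (if j == i then [set 0 : R] else setT).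
  by case: ifP.
have mZi i : measurable (Zi i) by rewrite ZiE; exact: (measurable_rect (mI i)).
have Zi0 i : lebesgue_rV N (Zi i) = 0%E.
  rewrite ZiE (lebesgue_rV_rect (mI i)) (bigD1 i)//= eqxx.
  by rewrite lebesgue_measure_set1 mul0e.
pose F k := if insub k is Some i then Zi i else set0.
have mF k : measurable (F k) by rewrite /F; case: insub.
have mZ : measurable (\bigcup_k F k) by exact: bigcupT_measurable.
exists (\bigcup_k F k); split => //; last first.
  by move=> x Zx i; apply/eqP => xi; apply: Zx; exists (val i) => //; rewrite /F valK.
apply/eqP; rewrite eq_le measure_ge0 andbT.
apply: le_trans (measure_sigma_subadditive _ mF mZ (@subset_refl _ _)) _.
by rewrite eseries0// => k _ _; rewrite /F; case: insub => [i|]; [exact: Zi0|exact: measure0].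
Qed.

Lemma sort_abs (x : 'rV[R]_N) : exists (s : seq R) (p : 'S_N),
  [/\ perm_eq s [seq `|x ord0 i| | i <- enum 'I_N], size s = N,
     forall i : 'I_N, nth 0 s i = `|x ord0 (p i)| &
     forall k, (k < N)%N -> 0 <= gap (nth 0 s) k].
Proof.
pose t := [tuple `|x ord0 i| | i < N].
have /tuple_permP[p sE] : perm_eq (sort <=%R t) t by rewrite perm_sort.
have sz : size (sort <=%R t) = N by rewrite size_sort size_tuple.
have nthE (i : 'I_N) : nth 0 (sort <=%R t) i = `|x ord0 (p i)|.
  by rewrite sE -tnth_nth !tnth_mktuple.
exists (sort <=%R t), p; split => //.
  by rewrite perm_sort /= enumT.
have srt : sorted <=%R (sort <=%R t) by apply: sort_sorted; exact: le_total.
case=> [|k] kN; first by rewrite /gap (nthE (Ordinal kN)).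
rewrite /gap subr_ge0.
by apply: (sorted_leq_nth le_trans le_refl) => //; rewrite inE sz// ltnW.
Qed.

Lemma quotient_fun_le_chain_bound (f : mpoly.mpoly N R[i]) (M : R) :
  ideal_J r f -> (0 < r)%N -> (r < N)%N -> (N < 2 * r)%N -> 1 <= M ->
  exists2 K : R, 0 <= K & forall x : 'rV[R]_N,
    (forall i, `|x ord0 i| <= M) -> (forall i, x ord0 i != 0) ->
    ComplexField.Normc.normc (quotient_fun r f x) ^+ 2 <=
    K * chain_bound ((2 * r)%:R^-1 - 1) M x.
Proof.
move=> fJ r0 rN N2r M1.
have [K K0 HK] := quotient_fun_gap_bound fJ r0 rN N2r M1.
exists K => // x xM x0.
have [s [p [sx sz sp gap0]]] := sort_abs x.
apply: le_trans (HK x (nth 0 s) p xM x0 sp gap0) _; apply: ler_wpM2l => //.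
set e := (2 * r)%:R^-1 - 1.
have b0 : 0 < (2 * r)%:R^-1 :> R by rewrite invr_gt0 ltr0n muln_gt0.
have b1 : (2 * r)%:R^-1 < 1 :> R by rewrite invf_lt1 ?ltr1n ?ltr0n; lia.
have gapE k : (k < N)%N -> `|nth 0 s k - nth 0 (0 :: s) k| = gap (nth 0 s) k.
  move=> kN; have := gap0 k kN.
  by case: k kN => [|k] kN; rewrite /gap [nth 0 (0 :: s) _]/= ?subr0 => /ger0_norm.
have [pos|/existsNP[k /not_implyP[kN gk]]] :=
    pselect (forall k, (k < N)%N -> 0 < gap (nth 0 s) k).
  have path_s : path <%R 0 s.
    apply/(pathP 0) => k; rewrite sz => kN; have := pos k kN.
    by case: k kN => [|k] kN //=; rewrite /gap subr_gt0.
  apply: le_trans (chain_le_chain_bound _ xM sx path_s); last first.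
    by rewrite /e; apply/andP; split; lra.
  rewrite chainE sz big_nat [leRHS]big_nat le_eqVlt; apply/orP; left; apply/eqP.
  by apply: eq_bigr => i iN; rewrite gapE.
(* A zero gap contributes 0 raised to a nonzero exponent, which is 0, so the left side vanishes. *)
rewrite big_mkord (bigD1 (Ordinal kN))//=.
have -> : gap (nth 0 s) k = 0 by apply/eqP; rewrite eq_le gap0// andbT leNgt; apply/negP.
rewrite powR0 ?mul0r ?chain_bound_ge0//.
by rewrite /e lt_eqF// subr_lt0.
Qed.

End local_integrability.

(** * The integral of the squared quotient over a unit ball *)

Theorem theorem5p6 (R : realType) (N r : nat)
  (r_gt0 : (0 < r)%N) (r_lt_N : (r < N)%N) (N_lt_2r : (N < 2 * r)%N)
  (f : mpoly.mpoly N R[i]) (fJ : @ideal_J R N r f) :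
  locally_L2 (quotient_fun r f).
Proof.
have [mRe mIm] := cmeasurable_quotient_fun r f.
split => // x.
(* Bounds every coordinate on the unit ball around [x]. *)
pose M := 1 + \sum_(i < N) `|x ord0 i|.
have S0 : 0 <= \sum_(i < N) `|x ord0 i| by exact: sumr_ge0.
have M1 : 1 <= M by rewrite lerDl.
have [K K0 HK] := quotient_fun_le_chain_bound fJ r_gt0 r_lt_N N_lt_2r M1.
set e := (2 * r)%:R^-1 - 1 in HK.
have b0 : 0 < (2 * r)%:R^-1 :> R by rewrite invr_gt0 ltr0n muln_gt0.
have b1 : (2 * r)%:R^-1 < 1 :> R by rewrite invf_lt1 ?ltr1n ?ltr0n; lia.
have e01 : -1 < e <= 0 by rewrite /e; apply/andP; split; lra.
exists (ball x 1); first by split; [exact: ball_open|exact: ballxx].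
have mU : measurable (ball x 1 : set 'rV[R]_N).
  by apply: sub_sigma_algebra; exact: ball_open.
have xM y : ball x 1 y -> forall i, `|y ord0 i| <= M.
  move=> [_ xy] i; have := xy ord0 i; rewrite /ball/= => xyi.
  have -> : y ord0 i = x ord0 i - (x ord0 i - y ord0 i) by ring.
  apply: le_trans (ler_normB _ _) _; rewrite addrC; apply: lerD; first exact: ltW.
  by rewrite (bigD1 i)//= lerDl sumr_ge0.
have mq : measurable_fun setT (fun y : 'rV[R]_N =>
    (ComplexField.Normc.normc (quotient_fun r f y) ^+ 2)%:E).
  by apply/measurable_EFinP; apply: measurable_normc; split.
have mc : measurable_fun setT (fun y : 'rV[R]_N => (chain_bound e M y)%:E).
  by apply/measurable_EFinP; exact: measurable_chain_bound.
(* The pointwise bound asks for nonzero coordinates, so a null set is discarded. *)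
have [Z [mZ Z0 ZP]] := lebesgue_rV_coord0 R N.
rewrite (ge0_negligible_integral mZ)//; last 2 first.
- by apply: measurable_funTS.
- by move=> y _; rewrite lee_fin exprn_ge0// normc_ge0.
apply: (@le_lt_trans _ _ (\int[lebesgue_rV N]_(y in (ball x 1 `\` Z)%classic)
    (K%:E * (chain_bound e M y)%:E))%E).
  apply: ge0_le_integral.
  - exact: measurableD.
  - by move=> y _; rewrite lee_fin exprn_ge0// normc_ge0.
  - exact: measurable_funTS.
  - by apply: emeasurable_funM => //; exact: measurable_funTS.
  by move=> y [xy Zy]; rewrite -EFinM lee_fin; apply: HK; [exact: xM|exact: ZP].
(* The cutoff in [link] keeps the integral over the whole space finite. *)
apply: (@le_lt_trans _ _ (\int[lebesgue_rV N]_(y in setT)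
    (K%:E * (chain_bound e M y)%:E))%E).
  apply: ge0_subset_integral => //.
  - exact: measurableD.
  - exact: emeasurable_funM.
  - by move=> y _; rewrite -EFinM lee_fin mulr_ge0// chain_bound_ge0.
rewrite ge0_integralZl_EFin//; last by move=> y _; rewrite lee_fin chain_bound_ge0.
rewrite lte_mul_pinfty// ?lee_fin//.
exact: integral_chain_bound_lty.
Qed.
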